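(* Let $H=\langle n_1,n_2,n_3,n_4\rangle$ be a numerical semigroup minimally generated by $4$ elements. If $H$ is almost symmetric of type $3$, then $I_H$ is generated by $\mathrm{RF}$-relations.
   Context: A numerical semigroup is a submonoid $H\subset\mathbb N$ with $0\in H$ and $\mathbb N\setminus H$ finite; we assume $H\ne\mathbb N$. $\mathrm F(H)=\max(\mathbb N\setminus H)$; $\mathrm{PF}(H)=\{f\in\mathbb Z\setminus H : f+n_i\in H\text{ for all }i\}$; $\mathrm{PF}'(H)=\mathrm{PF}(H)\setminus\{\mathrm F(H)\}$; the type of $H$ is $|\mathrm{PF}(H)|$; $H$ is almost symmetric if $2|\mathbb N\setminus H|=\mathrm F(H)+|\mathrm{PF}(H)|$. $K$ is a field and $I_H$ is the kernel of the $K$-algebra map $K[x_1,\dots,x_4]\to K[t]$, $x_i\mapsto t^{n_i}$. For $f\in\mathrm{PF}(H)$, a row-factorization matrix of $f$ is a $4\times 4$ integer matrix $(a_{ij})$ with $a_{ii}=-1$, $a_{ij}\in\mathbb N$ for $i\neq j$, and $\sum_j a_{ij}n_j=f$ for every $i$ (not necessarily unique). If $\mathbf a_1,\dots,\mathbf a_4$ are the rows of a row-factorization matrix of $f$ and $\mathbf a_{ij}=\mathbf a_i-\mathbf a_j$ ($i<j$), the binomial $x^{\mathbf a_{ij}^+}-x^{\mathbf a_{ij}^-}\in I_H$ is called an $\mathrm{RF}(f)$-relation; here $\mathbf a^+$ is obtained from $\mathbf a$ by replacing negative entries by $0$ and $\mathbf a^-=\mathbf a^+-\mathbf a$. An $\mathrm{RF}$-relation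 is an $\mathrm{RF}(f)$-relation for some $f\in\mathrm{PF}'(H)$. *)

(* Defs.v *)
From HB Require Import structures.
From mathcomp Require Import all_boot all_order all_algebra.
From mathcomp Require Import finmap mpoly.
From mathcomp Require Import boolp classical_sets cardinality.

Set Implicit Arguments.
Unset Strict Implicit.
Unset Printing Implicit Defensive.

Import Order.TTheory GRing.Theory Num.Theory.

Local Open Scope classical_set_scope.
Local Open Scope ring_scope.

Definition numerical_semigroup (H : set nat) : Prop :=
  [/\ H 0%N, (forall a b : nat, H a -> H b -> H (a + b)%N)
    & finite_set (~` H)].

Definition span_nat (k : nat) (n : 'I_k -> nat) (A : {set 'I_k}) : set nat :=
  [set m | exists c : 'I_k -> nat, m = (\sum_(i in A) c i * n i)%N].

(* Properness ranges over sets of indices, so minimality also forces the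
   generators to be pairwise distinct and nonzero. *)
Definition minimally_generated (k : nat) (n : 'I_k -> nat) (H : set nat) :
    Prop :=
  H = span_nat n [set: 'I_k]%SET /\
  forall A : {set 'I_k}, A \proper [set: 'I_k]%SET -> H <> span_nat n A.

(* [fset_set] of an infinite set is empty, and the maximum of the empty set
   is 0: the next definition is meaningful for a numerical semigroup H <> N,
   and [fset_set] is only applied below to sets that are then finite. *)
Definition Frobenius (H : set nat) : nat :=
  (\max_(m <- fset_set (~` H)) m)%N.

Definition in_int (H : set nat) : set int := [set Posz h | h in H].

Definition PF (k : nat) (n : 'I_k -> nat) (H : set nat) : set int :=
  [set f : int | ~ in_int H f /\ forall i : 'I_k, in_int H (f + (n i)%:Z)].

Definition PF' (k : nat) (n : 'I_k -> nat) (H : set nat) : set int :=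
  PF n H `\ (Frobenius H)%:Z.

Definition semigroup_type (k : nat) (n : 'I_k -> nat) (H : set nat) : nat :=
  #|` fset_set (PF n H)|.

Definition almost_symmetric (k : nat) (n : 'I_k -> nat) (H : set nat) : Prop :=
  (2 * #|` fset_set (~` H)| = Frobenius H + semigroup_type n H)%N.

Definition semigroup_ideal (K : fieldType) (k : nat) (n : 'I_k -> nat) :
    set {mpoly K[k]} :=
  [set p | mmap (@polyC K) (fun i : 'I_k => 'X^(n i)) p = 0].
Arguments semigroup_ideal K {k} n _ : assert.

Definition RF_matrix (k : nat) (n : 'I_k -> nat) (f : int) (A : 'M[int]_k) :
    Prop :=
  [/\ (forall i : 'I_k, A i i = -1),
      (forall i j : 'I_k, i != j -> 0 <= A i j)
    & (forall i : 'I_k, \sum_j A i j * (n j)%:Z = f)].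

Definition pos_part (k : nat) (a : 'rV[int]_k) : 'rV[int]_k :=
  \row_j Num.max (a 0 j) 0.

Definition neg_part (k : nat) (a : 'rV[int]_k) : 'rV[int]_k :=
  pos_part a - a.

(* Only used for vectors with nonnegative entries, on which the absolute value
   is the identity. *)
Definition monom (K : fieldType) (k : nat) (a : 'rV[int]_k) : {mpoly K[k]} :=
  'X_[[multinom `|a 0%R j|%N | j < k]].

Definition RF_relation_of (K : fieldType) (k : nat) (n : 'I_k -> nat)
    (f : int) : set {mpoly K[k]} :=
  [set p | exists (A : 'M[int]_k) (i j : 'I_k),
     [/\ RF_matrix n f A, (i < j)%N
       & p = monom K (pos_part (row i A - row j A))
             - monom K (neg_part (row i A - row j A))]].
Arguments RF_relation_of K {k} n f _ : assert.

Definition RF_relation (K : fieldType) (k : nat) (n : 'I_k -> nat)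
    (H : set nat) : set {mpoly K[k]} :=
  [set p | exists2 f : int, PF' n H f & RF_relation_of K n f p].
Arguments RF_relation K {k} n H _ : assert.

Definition ideal_generated (R : comNzRingType) (S : set R) : set R :=
  [set p | exists (r : nat) (q g : 'I_r -> R),
     (forall i, S (g i)) /\ p = \sum_i q i * g i].

(* Main.v *)
(* Put F := F(H) and let f, g be the elements of PF'(H). Almost symmetry means
   that f + g = F and that every integer x satisfies x \in H, F - x \in H or
   x \in {f, g}. Let J be the ideal of the RF-relations, and suppose by induction
   that two monomials of the same weight less than h are congruent modulo J. Then
   monomials of weight h with a common variable are congruent too. If x^a and x^b
   of weight h are incongruent, x_i dividing x^a and x_j dividing x^b, then
   h - n_i - n_j lies neither in H nor in {f, g}, so F + n_i + n_j - h \in H, while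
   p + n_i + n_j - h \notin H for p = f, g: in the excluded cases a - b would be the
   difference of rows i and j of some row-factorization matrix, up to a common
   monomial factor. The congruence classes partition the indices occurring in
   factorizations of h, and for each shape of this partition a comparison of
   the factorizations of f + n_i, g + n_i and F + n_i yields a contradiction. *)
From Stdlib Require Import ZArith Lia.
Require Import Defs.
From mathcomp Require Import all_boot all_order all_algebra.
From mathcomp Require Import mpoly classical_sets.
From mathcomp Require Import finmap boolp cardinality zify.

Set Implicit Arguments.
Unset Strict Implicit.

Import Order.TTheory GRing.Theory Num.Theory.

(** * Four-generator arithmetic over the integers *)

Local Open Scope Z_scope.

(** The recurring contradiction is a comparison of coefficients. For incongruent indices i, j,
    [cr_F] writes F as h - n_i - n_j plus multiples of the other two generators, since a further n_i
    or n_j would put F in H. A row of f is set against such an expression: if none of its entries is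
    larger, F - f = g lies in H; if a wrong entry is larger, [cr_f], or the relation obtained by
    subtracting two expressions of F, is violated. So a specified entry of the row must be positive,
    that is, f + n_i - n_j is in H for specified i, j, and [excl] then makes an entry of a row of g
    vanish. Once f + n_i and g + n_i are multiples of one and the same generator, f - g or g - f
    lies in H, which pseudo-Frobenius numbers forbid. Rows are not unique, so the facts passed
    between lemmas are mostly memberships in H rather than entries of one chosen matrix. Over Z with
    four named generators, negative arguments of a membership are harmless and relabelling the
    indices is an exchange of arguments. *)

Definition gens (n1 n2 n3 n4 x : Z) : Prop :=
  exists a b c d, (0 <= a /\ 0 <= b /\ 0 <= c /\ 0 <= d) /\
    x = a * n1 + b * n2 + c * n3 + d * n4.

Definition notin3 (p q r x : Z) : Prop :=
  forall b c d, 0 <= b -> 0 <= c -> 0 <= d -> x <> b * p + c * q + d * r.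

(** F(H) appears only as [f + g], so the whole situation is symmetric in [f] and [g]. *)
Record almost_sym (n1 n2 n3 n4 f g : Z) : Prop := AlmostSym {
  as_F : ~ gens n1 n2 n3 n4 (f + g);
  as_f : ~ gens n1 n2 n3 n4 f;
  as_g : ~ gens n1 n2 n3 n4 g;
  as_neq : f <> g;
  as_pos : 0 < f /\ 0 < g /\ 0 < n1 /\ 0 < n2 /\ 0 < n3 /\ 0 < n4;
  as_f1 : gens n1 n2 n3 n4 (f + n1);
  as_f2 : gens n1 n2 n3 n4 (f + n2);
  as_f3 : gens n1 n2 n3 n4 (f + n3);
  as_f4 : gens n1 n2 n3 n4 (f + n4);
  as_g1 : gens n1 n2 n3 n4 (g + n1);
  as_g2 : gens n1 n2 n3 n4 (g + n2);
  as_g3 : gens n1 n2 n3 n4 (g + n3);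
  as_g4 : gens n1 n2 n3 n4 (g + n4);
  as_min1 : notin3 n2 n3 n4 n1;
  as_min2 : notin3 n1 n3 n4 n2;
  as_min3 : notin3 n1 n2 n4 n3;
  as_min4 : notin3 n1 n2 n3 n4;
  as_tri : forall x, gens n1 n2 n3 n4 x \/ gens n1 n2 n3 n4 (f + g - x) \/
                     x = f \/ x = g }.

(* What follows when x^a and x^b have weight h and are incongruent modulo the
   RF-relations, x^a being divisible by the variable of the generator p and x^b
   by that of q. *)
Record cross (n1 n2 n3 n4 f g h p q : Z) : Prop := Cross {
  cr_p : gens n1 n2 n3 n4 (h - p);
  cr_q : gens n1 n2 n3 n4 (h - q);
  cr_pq : ~ gens n1 n2 n3 n4 (h - p - q);
  cr_F : gens n1 n2 n3 n4 (f + g + p + q - h);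
  cr_f : ~ gens n1 n2 n3 n4 (f + p + q - h);
  cr_g : ~ gens n1 n2 n3 n4 (g + p + q - h) }.

(** Only a lower bound: [a] is at most the least positive multiplier carrying [n1] into the
    semigroup of the other three, and need not attain it. *)
Definition lowest (n1 n2 n3 n4 a : Z) : Prop :=
  forall m b c d, 0 < m -> 0 <= b -> 0 <= c -> 0 <= d ->
    m * n1 = b * n2 + c * n3 + d * n4 -> a <= m.

Ltac inH a b c d := exists a, b, c, d; split; [split; [|split; [|split]]; lia | lia].
Ltac bad H a b c d := exfalso; apply H; inH a b c d.

(** * Invariance under relabelling the generators and exchanging f and g *)

Section Perm.
Variables n1 n2 n3 n4 : Z.

Lemma gens23 x : gens n1 n2 n3 n4 x <-> gens n1 n3 n2 n4 x.
Proof.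
by split=> -[a [b [c [d [[? [? [? ?]]] ->]]]]]; inH a c b d.
Qed.

Lemma gens34 x : gens n1 n2 n3 n4 x <-> gens n1 n2 n4 n3 x.
Proof.
by split=> -[a [b [c [d [[? [? [? ?]]] ->]]]]]; inH a b d c.
Qed.

End Perm.

Ltac permute_notin :=
  match goal with H : notin3 _ _ _ ?x |- notin3 _ _ _ ?x =>
    let b := fresh in let c := fresh in let d := fresh in let E := fresh in
    intros b c d ? ? ? E;
    first [ apply (H b c d); lia | apply (H c b d); lia | apply (H b d c); lia
          | apply (H d c b); lia | apply (H c d b); lia | apply (H d b c); lia]
  end.

Ltac permute_tri L :=
  match goal with H : (forall x, _ \/ _) |- (forall x, _ \/ _) =>
    let x := fresh in
    intros x; destruct (H x) as [?|[?|?]];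
    [left; by apply/L | right; left; by apply/L | right; by right] end.

Ltac permute_sym L :=
  case=> *; constructor;
  first [by apply/L | by move/L | lia | permute_notin | permute_tri L].

Lemma almost_sym23 n1 n2 n3 n4 f g :
  almost_sym n1 n2 n3 n4 f g -> almost_sym n1 n3 n2 n4 f g.
Proof. by permute_sym gens23. Qed.

Lemma almost_sym34 n1 n2 n3 n4 f g :
  almost_sym n1 n2 n3 n4 f g -> almost_sym n1 n2 n4 n3 f g.
Proof. by permute_sym gens34. Qed.

Lemma almost_symC n1 n2 n3 n4 f g :
  almost_sym n1 n2 n3 n4 f g -> almost_sym n1 n2 n3 n4 g f.
Proof.
case=> ? ? ? ? ? ? ? ? ? ? ? ? ? ? ? ? ? tri.
constructor=> //; first [by rewrite Z.add_comm | lia | idtac].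
by move=> x; rewrite Z.add_comm; case: (tri x); tauto.
Qed.

Ltac permute_cross L := by case=> ? ? ? ? ? ?; constructor; (apply/L || move/L).

Lemma cross23 n1 n2 n3 n4 f g h p q :
  cross n1 n2 n3 n4 f g h p q -> cross n1 n3 n2 n4 f g h p q.
Proof. permute_cross gens23. Qed.

Lemma cross34 n1 n2 n3 n4 f g h p q :
  cross n1 n2 n3 n4 f g h p q -> cross n1 n2 n4 n3 f g h p q.
Proof. permute_cross gens34. Qed.

Lemma crossC n1 n2 n3 n4 f g h p q :
  cross n1 n2 n3 n4 f g h p q -> cross n1 n2 n3 n4 g f h p q.
Proof. by case=> ? ? ? ? ? ?; constructor; rewrite // (Z.add_comm g). Qed.

(** * Rows of pseudo-Frobenius numbers and exclusions between them *)

Section Basics.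
Variables n1 n2 n3 n4 : Z.
Local Notation gens := (gens n1 n2 n3 n4).

Lemma gensD x y : gens x -> gens y -> gens (x + y).
Proof.
case=> [a [b [c [d [? ->]]]]] [a' [b' [c' [d' [? ->]]]]].
inH (a + a') (b + b') (c + c') (d + d').
Qed.

(** For [x = f + n1] this is row 1 of a row-factorization matrix: the vanishing coefficient of [n1]
    becomes the entry -1 of f. It is also applied to the elements given by [cr_F]. *)
Lemma row1 x : gens x -> ~ gens (x - n1) ->
  exists b c d, (0 <= b /\ 0 <= c /\ 0 <= d) /\ x = b * n2 + c * n3 + d * n4.
Proof.
case=> a [b [c [d [? ->]]]] no; exists b, c, d; split; first lia.
case: (Z_le_gt_dec a 0) => ?; last by bad no (a - 1) b c d.
have -> : a = 0 by lia.
lia.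
Qed.

Lemma row2 x : gens x -> ~ gens (x - n2) ->
  exists a c d, (0 <= a /\ 0 <= c /\ 0 <= d) /\ x = a * n1 + c * n3 + d * n4.
Proof.
case=> a [b [c [d [? ->]]]] no; exists a, c, d; split; first lia.
case: (Z_le_gt_dec b 0) => ?; last by bad no a (b - 1) c d.
have -> : b = 0 by lia.
lia.
Qed.

Lemma row3 x : gens x -> ~ gens (x - n3) ->
  exists a b d, (0 <= a /\ 0 <= b /\ 0 <= d) /\ x = a * n1 + b * n2 + d * n4.
Proof.
case=> a [b [c [d [? ->]]]] no; exists a, b, d; split; first lia.
case: (Z_le_gt_dec c 0) => ?; last by bad no a b (c - 1) d.
have -> : c = 0 by lia.
lia.
Qed.

Lemma row4 x : gens x -> ~ gens (x - n4) ->
  exists a b c, (0 <= a /\ 0 <= b /\ 0 <= c) /\ x = a * n1 + b * n2 + c * n3.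
Proof.
case=> a [b [c [d [? ->]]]] no; exists a, b, c; split; first lia.
case: (Z_le_gt_dec d 0) => ?; last by bad no a b c (d - 1).
have -> : d = 0 by lia.
lia.
Qed.

Variables f g : Z.
Hypothesis A : almost_sym n1 n2 n3 n4 f g.

(** The two memberships add up to [f + g]. Thus a positive entry at q in a row p of [f] forces the
    entry at p to be zero in every row q of [g]. *)
Lemma excl p q : gens (f + p - q) -> gens (g + q - p) -> False.
Proof.
move=> fp gq; apply: (as_F A); have := gensD fp gq.
by replace (f + p - q + (g + q - p)) with (f + g) by lia.
Qed.

(** A nonzero element [x - y] of H contains some generator; moving that generator to the
    pseudo-Frobenius number [y] writes [x] as a sum of two elements of H. *)
Lemma no_diff x y : (x = f /\ y = g) \/ (x = g /\ y = f) ->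
  gens (x - y) -> x <> y -> False.
Proof.
move=> xy [a [b [c [d [pos E]]]]] neq.
have Hk : forall k, gens (y + k) -> gens (x - y - k) -> False.
  move=> k Hy Hxy; have := gensD Hy Hxy.
  have -> : y + k + (x - y - k) = x by lia.
  by case: xy => -[-> _]; [apply: (as_f A) | apply: (as_g A)].
have [y1 [y2 [y3 y4]]] :
    gens (y + n1) /\ gens (y + n2) /\ gens (y + n3) /\ gens (y + n4).
  by case: xy => -[_ ->]; case: A; tauto.
case: (Z_le_gt_dec a 0) => ?; last by apply: (Hk _ y1); inH (a - 1) b c d.
case: (Z_le_gt_dec b 0) => ?; last by apply: (Hk _ y2); inH a (b - 1) c d.
case: (Z_le_gt_dec c 0) => ?; last by apply: (Hk _ y3); inH a b (c - 1) d.
case: (Z_le_gt_dec d 0) => ?; last by apply: (Hk _ y4); inH a b c (d - 1).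
apply: neq.
have [? [? [? ?]]] : a = 0 /\ b = 0 /\ c = 0 /\ d = 0 by lia.
by subst a b c d; lia.
Qed.

(** The final blow in several cases, where [f + p = c * k] and [g + p = d * k]: depending on the
    sign of [c - d], one of [f - g], [g - f] is a multiple of [k] in H. *)
Lemma no_multiple k c d : gens k -> f = g + (c - d) * k -> False.
Proof.
move=> Hk E.
have Hm : forall m, 0 <= m -> gens (m * k).
  refine (natlike_ind (fun m => gens (m * k)) _ _) => [|m _ IH].
    by inH 0 0 0 0.
  by replace (Z.succ m * k) with (m * k + k) by lia; apply: gensD.
case: (Z_le_gt_dec d c) => cd.
- apply: (@no_diff f g); [by left | | exact: (as_neq A)].
  by replace (f - g) with ((c - d) * k) by lia; apply: Hm; lia.
- apply: (@no_diff g f); [by right | | exact: nesym (as_neq A)].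
  by replace (g - f) with ((d - c) * k) by lia; apply: Hm; lia.
Qed.

End Basics.
Arguments excl {n1 n2 n3 n4 f g} A {p q}.

Lemma gens2 n1 n2 n3 n4 : gens n1 n2 n3 n4 n2.
Proof. inH 0 1 0 0. Qed.
Lemma gens3 n1 n2 n3 n4 : gens n1 n2 n3 n4 n3.
Proof. inH 0 0 1 0. Qed.
Lemma gens4 n1 n2 n3 n4 : gens n1 n2 n3 n4 n4.
Proof. inH 0 0 0 1. Qed.

(* No factorization of F + p + q - h uses the generator p or q. *)
Lemma cross_noF n1 n2 n3 n4 f g h p q : almost_sym n1 n2 n3 n4 f g ->
  cross n1 n2 n3 n4 f g h p q ->
  ~ gens n1 n2 n3 n4 (f + g + p + q - h - p) /\
  ~ gens n1 n2 n3 n4 (f + g + p + q - h - q).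
Proof.
move=> A [Hp Hq _ _ _ _]; split=> HF; apply: (as_F A).
- have := gensD Hq HF; by replace (h - q + (f + g + p + q - h - p)) with (f + g) by lia.
- have := gensD Hp HF; by replace (h - p + (f + g + p + q - h - q)) with (f + g) by lia.
Qed.

(** * Two classes of two indices, one without mixed factorizations *)

(** [cr_F] for the pairs (1,2) and (4,2) gives F + n1 + n2 - h = c n3 + d n4 and F + n4 + n2 - h = a
    n1 + c' n3, hence (1 + a) n1 + c' n3 = (1 + d) n4 + c n3. The two [lowest] bounds and [cr_pq]
    force c = c' and d = be - 1. *)
Lemma pure_value n1 n2 n3 n4 f g h al be :
  almost_sym n1 n2 n3 n4 f g ->
  cross n1 n2 n3 n4 f g h n1 n2 -> cross n1 n2 n3 n4 f g h n1 n3 ->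
  cross n1 n2 n3 n4 f g h n4 n2 -> cross n1 n2 n3 n4 f g h n4 n3 ->
  h = al * n1 -> h = be * n4 ->
  lowest n1 n2 n3 n4 al -> lowest n4 n1 n2 n3 be ->
  exists c, 0 <= c /\ f + g = (al - 1) * n1 - n2 + c * n3 + (be - 1) * n4.
Proof.
move=> A c12 c13 c42 c43 ha hb la lb.
have [no1 no2] := cross_noF A c12.
have [no4 no2'] := cross_noF A c42.
case: (cr_F c12) => x1 [x2 [c [d [pos E]]]].
case: (cr_F c42) => a [y2 [c' [d' [pos' E']]]].
case: (Z_le_gt_dec x1 0) => ?; last by bad no1 (x1 - 1) x2 c d.
case: (Z_le_gt_dec x2 0) => ?; last by bad no2 x1 (x2 - 1) c d.
case: (Z_le_gt_dec y2 0) => ?; last by bad no2' a (y2 - 1) c' d'.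
case: (Z_le_gt_dec d' 0) => ?; last by bad no4 a y2 c' (d' - 1).
have [x10 [x20 [y20 d0]]] : x1 = 0 /\ x2 = 0 /\ y2 = 0 /\ d' = 0 by lia.
subst x1 x2 y2 d'.
(* Otherwise trading [be * n4] for [al * n1] would bring [n1] into a factorization that cannot
   contain it. *)
case: (Z_le_gt_dec be d) => ?.
  case: (Z_le_gt_dec al 0) => ?; last by bad no1 (al - 1) 0 c (d - be).
  case: (cr_p c12) => k1 [k2 [k3 [k4 [? Ek]]]]; exfalso.
  have := as_pos A; nia.
case: (Z_le_gt_dec c' c) => ?.
- have ?: al <= 1 + a by apply: (la _ 0 (c - c') (1 + d)); lia.
  case: (Z_le_gt_dec c c') => ?; last first.
    case: (Z_le_gt_dec al a) => ?.
      case: (Z_le_gt_dec be 0) => ?; last by bad no4 (a - al) 0 c' (be - 1).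
      case: (cr_p c12) => k1 [k2 [k3 [k4 [? Ek]]]]; exfalso.
      have := as_pos A; nia.
    have Ea : a = al - 1 by lia.
    subst a; bad (cr_pq c43) 0 0 (c - c' - 1) d.
  have Ec : c' = c by lia.
  subst c'.
  have ?: be <= 1 + d by apply: (lb _ (1 + a) 0 0); lia.
  have Ed : d = be - 1 by lia.
  by subst d; exists c; split; lia.
- have ?: be <= 1 + d by apply: (lb _ (1 + a) 0 (c' - c)); lia.
  have Ed : d = be - 1 by lia.
  by subst d; bad (cr_pq c13) a 0 (c' - c - 1) 0.
Qed.

(** Exchanging 2 and 3 in [pure_value] gives a second expression of F, and subtraction gives (c + 1)
    n3 = (c' + 1) n2. Row 2 of f then either stays below the first expression, so that g is in H, or
    has enough n3 to be traded for n2, so that f is in H. *)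
Lemma no_pure n1 n2 n3 n4 f g h al be :
  almost_sym n1 n2 n3 n4 f g ->
  cross n1 n2 n3 n4 f g h n1 n2 -> cross n1 n2 n3 n4 f g h n1 n3 ->
  cross n1 n2 n3 n4 f g h n4 n2 -> cross n1 n2 n3 n4 f g h n4 n3 ->
  h = al * n1 -> h = be * n4 ->
  lowest n1 n2 n3 n4 al -> lowest n4 n1 n2 n3 be -> False.
Proof.
move=> A c12 c13 c42 c43 ha hb la lb.
have [c [? E]] := pure_value A c12 c13 c42 c43 ha hb la lb.
have la' : lowest n1 n3 n2 n4 al.
  by move=> m x y z *; apply: (la m y x z); lia.
have lb' : lowest n4 n1 n3 n2 be.
  by move=> m x y z *; apply: (lb m x z y); lia.
have [c' [? E']] := pure_value (almost_sym23 A) (cross23 c13) (cross23 c12)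
                      (cross23 c43) (cross23 c42) ha hb la' lb'.
have nof2 : ~ gens n1 n2 n3 n4 (f + n2 - n2).
  by replace (f + n2 - n2) with (f) by lia; apply: (as_f A).
have [a [u [d [? Ef]]]] := row2 (as_f2 A) nof2.
case: (Z_le_gt_dec (al - 1) a) => ?; first by bad (cr_f c12) (a - al + 1) 0 u d.
case: (Z_le_gt_dec (be - 1) d) => ?; first by bad (cr_f c42) a 0 u (d - be + 1).
case: (Z_le_gt_dec u c) => ?; last by bad (as_f A) a c' (u - c - 1) d.
bad (as_g A) (al - 1 - a) 0 (c - u) (be - 1 - d).
Qed.

(** * Three indices in the support *)

Lemma not_gens_f k n1 n2 n3 n4 f g : almost_sym n1 n2 n3 n4 f g ->
  ~ gens n1 n2 n3 n4 (f + k - k).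
Proof. by move=> A; replace (f + k - k) with f by lia; apply: (as_f A). Qed.

Section Two.
Variables n1 n2 n3 n4 h al g23 g24 g32 g34 : Z.
Local Notation gens := (gens n1 n2 n3 n4).
Hypotheses (ha : h = al * n1) (low : lowest n1 n2 n3 n4 al).
Hypothesis h4 : ~ gens (h - n4).
Hypotheses (p23 : 0 <= g23) (p24 : 0 <= g24) (p32 : 0 <= g32) (p34 : 0 <= g34).
Hypothesis g_le : g34 <= g24.

(** Index 1 is incongruent to 2 and 3, and 4 is outside the support. The two expressions of F differ
    by (g32 + 1) n2 = (g23 + 1) n3 + (g24 - g34) n4; [g_le], which makes the last coefficient
    nonnegative, is arranged by exchanging 2 and 3. *)
Record two (f g : Z) : Prop := Two {
  two_A : almost_sym n1 n2 n3 n4 f g;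
  two_12 : cross n1 n2 n3 n4 f g h n1 n2;
  two_13 : cross n1 n2 n3 n4 f g h n1 n3;
  two_E2 : f + g = (al - 1) * n1 - n2 + g23 * n3 + g24 * n4;
  two_E3 : f + g = (al - 1) * n1 + g32 * n2 - n3 + g34 * n4 }.

Lemma twoC f g : two f g -> two g f.
Proof.
case=> A c12 c13 E2 E3; constructor;
  by [apply: almost_symC | apply: crossC | rewrite Z.add_comm].
Qed.

(** In row 3 of f the entry at n2 is at most g32, or it could be traded by the relation between the
    two expressions; so the entry at n4 must exceed g34. *)
Lemma two_34 f g : two f g -> gens (f + n3 - n4).
Proof.
case=> A c12 c13 E2 E3.
have [a [u [d [? Ef]]]] := row3 (as_f3 A) (not_gens_f (k := n3) A).
case: (Z_le_gt_dec (al - 1) a) => ?; first by bad (cr_f c13) (a - al + 1) u 0 d.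
case: (Z_le_gt_dec u g32) => ?; last first.
  by bad (as_f A) a (u - 1 - g32) g23 (g24 - g34 + d).
case: (Z_le_gt_dec d g34) => ?.
  by bad (as_g A) (al - 1 - a) (g32 - u) 0 (g34 - d).
inH a u 0 (d - 1).
Qed.

(** As h - n4 is not in H, almost symmetry puts F + n4 - h in H: the alternative h - n4 = f or g
    contradicts [two_34]. This is the expression of F against which row 4 is compared. *)
Lemma two_row4 f g : two f g ->
  exists a d, (0 <= a /\ 1 <= d) /\ f + n4 = a * n1 + d * n2.
Proof.
move=> tw; have f34 := two_34 tw; have g34' := two_34 (twoC tw).
case: tw => A c12 c13 E2 E3.
have [k1 [k2 [k3 [k4 [? Eh]]]]] := cr_q c13.
have: gens (f + g + n4 - h).
  case: (as_tri A (h - n4)) => [//|[|[E|E]]].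
  - by replace (f + g - (h - n4)) with (f + g + n4 - h) by lia.
  - by exfalso; apply: (excl A (p := n4) (q := n3)) => //; inH k1 k2 k3 k4.
  - by exfalso; apply: (excl A (p := n3) (q := n4)) => //; inH k1 k2 k3 k4.
move=> [l1 [l2 [l3 [l4 [? El]]]]].
case: (Z_le_gt_dec l4 0) => ?; last first.
  by bad (as_F A) (k1 + l1) (k2 + l2) (k3 + l3 + 1) (k4 + l4 - 1).
have ?: l4 = 0 by lia. subst l4.
have no43 : ~ gens (f + n4 - n3).
  by move=> f43; apply: (excl A f43 g34').
have [a [b [c [? Ef]]]] := row4 (as_f4 A) (not_gens_f (k := n4) A).
case: (Z_le_gt_dec c 0) => ?; last by bad no43 a b (c - 1) 0.
have ?: c = 0 by lia. subst c.
case: (Z_le_gt_dec al a) => ?; first by bad no43 (k1 + a - al) (k2 + b) k3 k4.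
case: (Z_le_gt_dec b l2) => ?; first by bad (as_g A) (al + l1 - a) (l2 - b) l3 0.
by exists a, b; split; lia.
Qed.

Lemma two_14 f g : two f g -> gens (f + n1 - n4).
Proof.
move=> tw; have [a4 [d4 [? E4]]] := two_row4 (twoC tw).
case: tw => A c12 c13 E2 E3.
have no24 : ~ gens (f + n2 - n4).
  by move=> f24; apply: (excl A f24); inH a4 (d4 - 1) 0 0.
have [a [c [d [? Ef2]]]] := row2 (as_f2 A) (not_gens_f (k := n2) A).
case: (Z_le_gt_dec d 0) => ?; last by bad no24 a 0 c (d - 1).
have ?: d = 0 by lia. subst d.
case: (Z_le_gt_dec (al - 1) a) => ?; first by bad (cr_f c12) (a - al + 1) 0 c 0.
case: (Z_le_gt_dec c g23) => ?; first by bad (as_g A) (al - 1 - a) 0 (g23 - c) g24.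
case: (Z_le_gt_dec g24 g34) => ?.
  have ?: g24 = g34 by lia. by subst g24; bad (as_f A) a g32 (c - 1 - g23) 0.
have [b2 [b3 [b4 [? Ef1]]]] := row1 (as_f1 A) (not_gens_f (k := n1) A).
case: (Z_le_gt_dec b4 0) => ?; last by inH 0 b2 b3 (b4 - 1).
have ?: b4 = 0 by lia. subst b4.
(* From here row 1 of f is assumed free of n4. Equating rows 1 and 2 gives (1 + a) n1 = (b2 + 1) n2
   + (b3 - c) n3, where 1 + a < al. *)
case: (Z_le_gt_dec c b3) => ?.
  have := low (m := 1 + a) (b := b2 + 1) (c := b3 - c) (d := 0).
  by lia.
have [k1 [k2 [k3 [k4 [? Eh]]]]] := cr_q c12.
case: (Z_le_gt_dec k1 0) => ?; last by bad (cr_pq c12) (k1 - 1) k2 k3 k4.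
case: (Z_le_gt_dec k4 0) => ?; last by bad h4 k1 (k2 + 1) k3 (k4 - 1).
have [? ?]: k1 = 0 /\ k4 = 0 by lia. subst k1 k4.
(* Here h = (k2 + 1) n2 + k3 n3; subtracting the previous relation from it leaves another positive
   multiple of n1 below al. *)
case: (Z_le_gt_dec b2 k2) => ?.
  have := low (m := al - 1 - a) (b := k2 - b2) (c := k3 + c - b3) (d := 0).
  by lia.
case: (Z_le_gt_dec k3 b3) => ?; first by bad (as_f A) (al - 1) (b2 - k2 - 1) (b3 - k3) 0.
case: (Z_le_gt_dec b2 (k2 + 1 + g32)) => ?.
  by bad (as_g A) 0 (k2 + 1 + g32 - b2) (k3 - 1 - b3) g34.
(* Trading g32 + 1 copies of n2 produces g24 - g34 > 0 copies of n4. *)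
inH 0 (b2 - 1 - g32) (b3 + 1 + g23) (g24 - g34 - 1).
Qed.

Lemma two_41 f g : two f g -> exists d, f + n4 = d * n2.
Proof.
move=> tw; have g14 := two_14 (twoC tw).
have [a [d [? E]]] := two_row4 tw.
case: (Z_le_gt_dec a 0) => ?.
  have ?: a = 0 by lia. by subst a; exists d; lia.
exfalso; case: tw => A _ _ _ _; apply: (excl A (p := n4) (q := n1)) => //.
inH (a - 1) d 0 0.
Qed.

Lemma two_false f g : two f g -> False.
Proof.
move=> tw; have [d E] := two_41 tw; have [d' E'] := two_41 (twoC tw).
case: tw => A _ _ _ _.
apply: (no_multiple A (k := n2) (c := d) (d := d')); last lia.
exact: gens2.
Qed.

End Two.

Lemma no_two n1 n2 n3 n4 f g h al :
  almost_sym n1 n2 n3 n4 f g ->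
  cross n1 n2 n3 n4 f g h n1 n2 -> cross n1 n2 n3 n4 f g h n1 n3 ->
  h = al * n1 -> lowest n1 n2 n3 n4 al -> ~ gens n1 n2 n3 n4 (h - n4) -> False.
Proof.
move=> A c12 c13 ha low h4.
have [no12 no2] := cross_noF A c12; have [no13 no3] := cross_noF A c13.
have [x2 [u [v [? E]]]] := row1 (cr_F c12) no12.
case: (Z_le_gt_dec x2 0) => ?; last by bad no2 0 (x2 - 1) u v.
have ?: x2 = 0 by lia. subst x2.
have [u' [x3 [v' [? E']]]] := row1 (cr_F c13) no13.
case: (Z_le_gt_dec x3 0) => ?; last by bad no3 0 u' (x3 - 1) v'.
have ?: x3 = 0 by lia. subst x3.
case: (Z_le_gt_dec v' v) => ?.
  apply: (@two_false n1 n2 n3 n4 h al u v u' v' _ _ _ _ _ _ _ _ f g) => //; try lia.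
  by constructor=> //; lia.
apply: (@two_false n1 n3 n2 n4 h al u' v' u v _ _ _ _ _ _ _ _ f g) => //; try lia.
- by move=> m b c d *; apply: (low m c b d); lia.
- by move/gens23.
- by constructor; [exact: almost_sym23 | exact: cross23 | exact: cross23 | lia | lia].
Qed.

(** * A singleton class in a full support *)

Section Full.
Variables h al : Z.

(** [gij] is the coefficient of n_j in the expression of F in which n_i has coefficient -1. *)
Record full (n1 n2 n3 n4 g23 g24 g32 g34 g42 g43 f g : Z) : Prop := Full {
  fu_A : almost_sym n1 n2 n3 n4 f g;
  fu_12 : cross n1 n2 n3 n4 f g h n1 n2;
  fu_13 : cross n1 n2 n3 n4 f g h n1 n3;
  fu_14 : cross n1 n2 n3 n4 f g h n1 n4;
  fu_h : h = al * n1;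
  fu_low : lowest n1 n2 n3 n4 al;
  fu_pos : (0 <= g23 /\ 0 <= g24 /\ 0 <= g32) /\ (0 <= g34 /\ 0 <= g42 /\ 0 <= g43);
  fu_E2 : f + g = (al - 1) * n1 - n2 + g23 * n3 + g24 * n4;
  fu_E3 : f + g = (al - 1) * n1 + g32 * n2 - n3 + g34 * n4;
  fu_E4 : f + g = (al - 1) * n1 + g42 * n2 + g43 * n3 - n4 }.

(** An orientation of the cycle 2, 3, 4: consecutive expressions of F are compared at the third
    index. The opposite orientation is obtained by exchanging 3 and 4. *)
Definition turn (g23 g24 g32 g34 g42 g43 : Z) : Prop :=
  g34 < g24 /\ g42 < g32 /\ g23 < g43.

Lemma fullC n1 n2 n3 n4 g23 g24 g32 g34 g42 g43 f g :
  full n1 n2 n3 n4 g23 g24 g32 g34 g42 g43 f g ->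
  full n1 n2 n3 n4 g23 g24 g32 g34 g42 g43 g f.
Proof.
case=> A c12 c13 c14 ? ? ? E2 E3 E4; constructor=> //;
  by [apply: almost_symC | apply: crossC | rewrite Z.add_comm].
Qed.

Lemma full_rot n1 n2 n3 n4 g23 g24 g32 g34 g42 g43 f g :
  full n1 n2 n3 n4 g23 g24 g32 g34 g42 g43 f g ->
  full n1 n3 n4 n2 g34 g32 g43 g42 g23 g24 f g.
Proof.
case=> A c12 c13 c14 ? low ? E2 E3 E4; constructor=> //; try lia.
- exact/almost_sym34/almost_sym23.
- exact/cross34/cross23.
- exact/cross34/cross23.
- exact/cross34/cross23.
- by move=> m b c d *; apply: (low m d b c); lia.
Qed.

Lemma full_swap n1 n2 n3 n4 g23 g24 g32 g34 g42 g43 f g :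
  full n1 n2 n3 n4 g23 g24 g32 g34 g42 g43 f g ->
  full n1 n2 n4 n3 g24 g23 g42 g43 g32 g34 f g.
Proof.
case=> A c12 c13 c14 ? low ? E2 E3 E4; constructor=> //; try lia.
- exact/almost_sym34.
- exact/cross34.
- exact/cross34.
- exact/cross34.
- by move=> m b c d *; apply: (low m b d c); lia.
Qed.

(** Row 2 of f must exceed the expression [fu_E2] at n3 or n4. Were the matching inequality between
    the gij false, the difference of two expressions would trade the excess for a positive multiple
    of n2 and put f in H. *)
Lemma full_row n1 n2 n3 n4 g23 g24 g32 g34 g42 g43 f g :
  full n1 n2 n3 n4 g23 g24 g32 g34 g42 g43 f g ->
  exists a c d, [/\ 0 <= a /\ 0 <= c /\ 0 <= d, a <= al - 2,
    f + n2 = a * n1 + c * n3 + d * n4 &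
    (g23 < c /\ g34 < g24) \/ (g24 < d /\ g43 < g23)].
Proof.
case=> A c12 c13 c14 ? low ? E2 E3 E4.
have [a [c [d [? Ef]]]] := row2 (as_f2 A) (not_gens_f (k := n2) A).
case: (Z_le_gt_dec (al - 1) a) => ?; first by bad (cr_f c12) (a - al + 1) 0 c d.
exists a, c, d; split=> //; first by lia.
case: (Z_le_gt_dec c g23) => ?.
- case: (Z_le_gt_dec d g24) => ?.
    by bad (as_g A) (al - 1 - a) 0 (g23 - c) (g24 - d).
  right; split; first lia.
  case: (Z_le_gt_dec g23 g43) => ?; last lia.
  by bad (as_f A) a g42 (c + g43 - g23) (d - 1 - g24).
- left; split; first lia.
  case: (Z_le_gt_dec g24 g34) => ?; last lia.
  by bad (as_f A) a g32 (c - 1 - g23) (d + g34 - g24).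
Qed.

Lemma turn_rot g23 g24 g32 g34 g42 g43 :
  turn g23 g24 g32 g34 g42 g43 -> turn g34 g32 g43 g42 g23 g24.
Proof. by rewrite /turn; lia. Qed.

(** [full_row] at 2, 3 and 4 gives three alternatives; each choice excludes the opposite choice at a
    neighbour, so all three agree. *)
Lemma full_turn n1 n2 n3 n4 g23 g24 g32 g34 g42 g43 f g :
  full n1 n2 n3 n4 g23 g24 g32 g34 g42 g43 f g ->
  turn g23 g24 g32 g34 g42 g43 \/ turn g24 g23 g42 g43 g32 g34.
Proof.
move=> fu; have fu' := full_rot fu; have fu'' := full_rot fu'.
have [? [? [? [_ _ _ r2]]]] := full_row fu.
have [? [? [? [_ _ _ r3]]]] := full_row fu'.
have [? [? [? [_ _ _ r4]]]] := full_row fu''.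
by rewrite /turn; lia.
Qed.

Lemma full_23 n1 n2 n3 n4 g23 g24 g32 g34 g42 g43 f g :
  full n1 n2 n3 n4 g23 g24 g32 g34 g42 g43 f g ->
  turn g23 g24 g32 g34 g42 g43 -> gens n1 n2 n3 n4 (f + n2 - n3).
Proof.
move=> fu [? [? ?]]; have [a [c [d [? _ E ?]]]] := full_row fu.
case: fu => _ _ _ _ _ _ ? _ _ _.
inH a 0 (c - 1) d.
Qed.

Lemma full_row2 n1 n2 n3 n4 g23 g24 g32 g34 g42 g43 f g :
  full n1 n2 n3 n4 g23 g24 g32 g34 g42 g43 f g ->
  turn g23 g24 g32 g34 g42 g43 ->
  exists a c, [/\ 0 <= a, a <= al - 2, g23 < c & f + n2 = a * n1 + c * n3].
Proof.
move=> fu tu; have [a [c [d [? ? E ?]]]] := full_row fu.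
(* Rotated [full_23] for g; by [excl] it clears the n4 entry in row 2 of f. *)
have g42' : gens n1 n2 n3 n4 (g + n4 - n2).
  have := full_23 (full_rot (full_rot (fullC fu))) (turn_rot (turn_rot tu)).
  by move/gens23/gens34.
case: tu => ? [? ?]; case: fu => A _ _ _ _ _ ? _ _ _.
case: (Z_le_gt_dec d 0) => ?.
  have ?: d = 0 by lia. by subst d; exists a, c; split; lia.
by exfalso; apply: (excl A (p := n2) (q := n4)) => //; inH a 0 c (d - 1).
Qed.

Lemma full_step n1 n2 n3 n4 g23 g24 g32 g34 g42 g43 f g :
  full n1 n2 n3 n4 g23 g24 g32 g34 g42 g43 f g ->
  turn g23 g24 g32 g34 g42 g43 ->
  gens n1 n2 n3 n4 (f + n1 - n2) -> gens n1 n2 n3 n4 (g + n1 - n3) -> False.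
Proof.
move=> fu tu f12 g13.
have [a2 [c3 [? ? ? E2]]] := full_row2 (fullC fu) tu.
have [a3 [c4 [? ? ? E3]]] := full_row2 (full_rot fu) (turn_rot tu).
have [a4 [c2 [? ? ? E4]]] := full_row2 (full_rot (full_rot fu)) (turn_rot (turn_rot tu)).
case: tu => ? [? ?]; case: fu => A c12 c13 c14 ha low ? F2 F3 F4.
case: (Z_le_gt_dec a2 0) => ?; last first.
  by apply: (excl A f12); inH (a2 - 1) 0 c3 0.
case: (Z_le_gt_dec a3 0) => ?; last first.
  by apply: (excl A (p := n3) (q := n1)) => //; inH (a3 - 1) 0 0 c4.
have [? ?]: a2 = 0 /\ a3 = 0 by lia. subst a2 a3.
(* [E4] plus [E2], compared with [F4], is a relation for the multiple [al - 1 - a4] of n1, too small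
   for [low]. *)
case: (Z_le_gt_dec c3 g43) => ?; last first.
  have := low (al - 1 - a4) (c2 - 1 - g42) (c3 - g43) 0; lia.
case: (Z_le_gt_dec g24 c4) => ?.
  have := low (al - 1) 0 (c3 - 1 - g23) (c4 - g24); lia.
(* Subtracting g = c3 n3 - n2 from [F4] computes f. *)
bad (cr_f c14) 0 (1 + g42) (g43 - c3) 0.
Qed.

Lemma full_sep n1 n2 n3 n4 g23 g24 g32 g34 g42 g43 f g :
  full n1 n2 n3 n4 g23 g24 g32 g34 g42 g43 f g ->
  turn g23 g24 g32 g34 g42 g43 ->
  gens n1 n2 n3 n4 (f + n1 - n2) -> gens n1 n2 n3 n4 (g + n1 - n2) -> False.
Proof.
move=> fu tu f12 g12.
have [a [c [? ? ? E]]] := full_row2 fu tu.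
have [a' [c' [? ? ? E']]] := full_row2 (fullC fu) tu.
case: fu => A c12 c13 c14 ha low ? F2 F3 F4.
case: (Z_le_gt_dec a 0) => ?; last first.
  by apply: (excl A (p := n2) (q := n1)) => //; inH (a - 1) 0 c 0.
case: (Z_le_gt_dec a' 0) => ?; last first.
  by apply: (excl A f12); inH (a' - 1) 0 c' 0.
have [? ?]: a = 0 /\ a' = 0 by lia. subst a a'.
apply: (no_multiple A (k := n3) (c := c) (d := c')); last lia.
exact: gens3.
Qed.

Lemma row1_some n1 n2 n3 n4 f g : almost_sym n1 n2 n3 n4 f g ->
  gens n1 n2 n3 n4 (f + n1 - n2) \/ gens n1 n2 n3 n4 (f + n1 - n3) \/
  gens n1 n2 n3 n4 (f + n1 - n4).
Proof.
move=> A; have [b [c [d [? E]]]] := row1 (as_f1 A) (not_gens_f (k := n1) A).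
case: (Z_le_gt_dec b 0) => ?; last by left; inH 0 (b - 1) c d.
case: (Z_le_gt_dec c 0) => ?; last by right; left; inH 0 b (c - 1) d.
case: (Z_le_gt_dec d 0) => ?; last by right; right; inH 0 b c (d - 1).
have [? [? ?]]: b = 0 /\ c = 0 /\ d = 0 by lia. subst b c d.
by have := as_pos A; lia.
Qed.

(** Row 1 of f and row 1 of g each have a positive entry among 2, 3, 4. Equal indices are settled by
    [full_sep], different ones by [full_step] after a rotation and possibly the exchange of f and
    g. *)
Lemma full_turn_false n1 n2 n3 n4 g23 g24 g32 g34 g42 g43 f g :
  full n1 n2 n3 n4 g23 g24 g32 g34 g42 g43 f g ->
  turn g23 g24 g32 g34 g42 g43 -> False.
Proof.
move=> fu tu; have gu := fullC fu.
have [fu' gu'] := (full_rot fu, full_rot gu); have tu' := turn_rot tu.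
have [fu'' gu''] := (full_rot fu', full_rot gu'); have tu'' := turn_rot tu'.
have R x : gens n1 n2 n3 n4 x -> gens n1 n3 n4 n2 x by move/gens23/gens34.
have R' x : gens n1 n2 n3 n4 x -> gens n1 n4 n2 n3 x by move/gens34/gens23.
have := row1_some (fu_A gu); have := row1_some (fu_A fu).
case=> [f2|[f3|f4]] [g2|[g3|g4]].
- exact: (full_sep fu tu f2 g2).
- exact: (full_step fu tu f2 g3).
- exact: (full_step gu'' tu'' (R' _ g4) (R' _ f2)).
- exact: (full_step gu tu g2 f3).
- exact: (full_sep fu' tu' (R _ f3) (R _ g3)).
- exact: (full_step fu' tu' (R _ f3) (R _ g4)).
- exact: (full_step fu'' tu'' (R' _ f4) (R' _ g2)).
- exact: (full_step gu' tu' (R _ g3) (R _ f4)).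
- exact: (full_sep fu'' tu'' (R' _ f4) (R' _ g4)).
Qed.

End Full.

Lemma no_full n1 n2 n3 n4 f g h al :
  almost_sym n1 n2 n3 n4 f g ->
  cross n1 n2 n3 n4 f g h n1 n2 -> cross n1 n2 n3 n4 f g h n1 n3 ->
  cross n1 n2 n3 n4 f g h n1 n4 ->
  h = al * n1 -> lowest n1 n2 n3 n4 al -> False.
Proof.
move=> A c12 c13 c14 ha low.
have [no12 no2] := cross_noF A c12; have [no13 no3] := cross_noF A c13.
have [no14 no4] := cross_noF A c14.
have [x2 [g23 [g24 [? E]]]] := row1 (cr_F c12) no12.
case: (Z_le_gt_dec x2 0) => ?; last by bad no2 0 (x2 - 1) g23 g24.
have [g32 [x3 [g34 [? E']]]] := row1 (cr_F c13) no13.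
case: (Z_le_gt_dec x3 0) => ?; last by bad no3 0 g32 (x3 - 1) g34.
have [g42 [g43 [x4 [? E'']]]] := row1 (cr_F c14) no14.
case: (Z_le_gt_dec x4 0) => ?; last by bad no4 0 g42 g43 (x4 - 1).
have [? [? ?]]: x2 = 0 /\ x3 = 0 /\ x4 = 0 by lia. subst x2 x3 x4.
have fu : full h al n1 n2 n3 n4 g23 g24 g32 g34 g42 g43 f g.
  by constructor=> //; lia.
case: (full_turn fu) => tu; first exact: full_turn_false fu tu.
exact: full_turn_false (full_swap fu) tu.
Qed.

(** * Two indices in the support *)

Section One.
Variables n1 n2 n3 n4 h al be t3 t4 : Z.
Local Notation gens := (gens n1 n2 n3 n4).
Hypotheses (ha : h = al * n1) (hb : h = be * n2).
Hypotheses (low1 : lowest n1 n2 n3 n4 al).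
Hypotheses (h3 : ~ gens (h - n3)) (h4 : ~ gens (h - n4)).
Hypothesis t_pos : 0 <= t3 /\ 0 <= t4.

Record one (f g : Z) : Prop := One {
  one_A : almost_sym n1 n2 n3 n4 f g;
  one_12 : cross n1 n2 n3 n4 f g h n1 n2;
  one_E : f + g = (al - 1) * n1 - n2 + t3 * n3 + t4 * n4 }.

Lemma oneC f g : one f g -> one g f.
Proof.
case=> A c12 E; constructor;
  by [apply: almost_symC | apply: crossC | rewrite Z.add_comm].
Qed.

(** Row 2 of f and row 1 of g must each exceed (t3, t4) somewhere, or the complementary number is in
    H. Their sum is F, so exceeding it only at different indices would give a relation for (al - a)
    n1 that [no3] forbids. *)
Lemma one_row f g : one f g ->
  (gens (f + n2 - n3) /\ gens (g + n1 - n3)) \/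
  (gens (f + n2 - n4) /\ gens (g + n1 - n4)).
Proof.
case=> A c12 E.
have [a [c [d [? E2]]]] := row2 (as_f2 A) (not_gens_f (k := n2) A).
have [b2 [b3 [b4 [? E1]]]] := row1 (as_g1 A) (not_gens_f (k := n1) (almost_symC A)).
case: (Z_le_gt_dec (al - 1) a) => ?; first by bad (cr_f c12) (a - al + 1) 0 c d.
case: (Z_le_gt_dec (be - 1) b2) => ?; first by bad (cr_g c12) 0 (b2 - be + 1) b3 b4.
have no3 u v : 0 < u -> 0 <= v -> (al - a) * n1 = b2 * n2 + u * n3 + v * n4 -> False.
  move=> ? ? Eu; case: (Z_le_gt_dec a 0) => ?.
    have ?: a = 0 by lia. by subst a; bad h3 0 b2 (u - 1) v.
  have := low1 (m := al - a) (b := b2) (c := u) (d := v); lia.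
case: (Z_le_gt_dec c t3) => ?.
  case: (Z_le_gt_dec d t4) => ?; first by bad (as_g A) (al - 1 - a) 0 (t3 - c) (t4 - d).
  case: (Z_le_gt_dec b4 t4) => ?.
    case: (Z_le_gt_dec b3 t3) => ?.
      by bad (as_f A) 0 (be - 1 - b2) (t3 - b3) (t4 - b4).
    by exfalso; apply: (no3 (c + b3 - t3) (d + b4 - t4)); lia.
  by right; split; [inH a 0 c (d - 1) | inH 0 b2 b3 (b4 - 1)].
case: (Z_le_gt_dec b3 t3) => ?.
  case: (Z_le_gt_dec b4 t4) => ?.
    by bad (as_f A) 0 (be - 1 - b2) (t3 - b3) (t4 - b4).
  by exfalso; apply: (no3 (c + b3 - t3) (d + b4 - t4)); lia.
by left; split; [inH a 0 (c - 1) d | inH 0 b2 (b3 - 1) b4].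
Qed.

(** [excl] clears the entries at 1 and 2 in row 3, so f + n3 and g + n3 are both multiples of n4. *)
Lemma one_same f g : one f g ->
  gens (f + n2 - n3) -> gens (g + n1 - n3) ->
  gens (g + n2 - n3) -> gens (f + n1 - n3) -> False.
Proof.
case=> A c12 E f23 g13 g23 f13.
have R x y : almost_sym n1 n2 n3 n4 x y -> gens (y + n2 - n3) -> gens (y + n1 - n3) ->
    exists d, x + n3 = d * n4.
  move=> Ax y2 y1.
  have [a [b [d [? Ex]]]] := row3 (as_f3 Ax) (not_gens_f (k := n3) Ax).
  case: (Z_le_gt_dec a 0) => ?; last first.
    by exfalso; apply: (excl Ax (p := n3) (q := n1)) => //; inH (a - 1) b 0 d.
  case: (Z_le_gt_dec b 0) => ?; last first.
    by exfalso; apply: (excl Ax (p := n3) (q := n2)) => //; inH a (b - 1) 0 d.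
  have [? ?]: a = 0 /\ b = 0 by lia. subst a b.
  by exists d; lia.
have [d Ed] := R _ _ A g23 g13.
have [d' Ed'] := R _ _ (almost_symC A) f23 f13.
apply: (no_multiple A (k := n4) (c := d) (d := d')); last lia.
exact: gens4.
Qed.

(** Since h - n3 and h - n4 are not in H, almost symmetry adds two expressions of F, through F + n3
    - h and F + n4 - h. Against them row 3 of g needs n4, which leaves only n1 in row 4 of f; that
    is impossible. *)
Lemma one_mixed f g : one f g ->
  gens (f + n2 - n3) -> gens (g + n1 - n3) ->
  gens (g + n2 - n4) -> gens (f + n1 - n4) -> False.
Proof.
move=> on f23 g13 g24 f14; case: on => A c12 E.
have no31 : ~ gens (f + n3 - n1) by move=> f31; apply: (excl A f31 g13).
have no42 : ~ gens (f + n4 - n2) by move=> f42; apply: (excl A f42 g24).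
have no32 : ~ gens (g + n3 - n2) by move=> g32; apply: (excl A f23 g32).
have no41 : ~ gens (g + n4 - n1) by move=> g41; apply: (excl A f14 g41).
have Hl k : gens (h - k) \/ gens (f + g + k - h) \/ h = f + k \/ h = g + k.
  case: (as_tri A (h - k)) => [|[|[?|?]]]; [by left| |right; right; lia|right; right; lia].
  by replace (f + g - (h - k)) with (f + g + k - h) by lia; right; left.
have h1 := cr_p c12; have h2 := cr_q c12.
have [l1 [l2 [l3 [l4 [? El]]]]] : gens (f + g + n3 - h).
  case: (Hl n3) => [/h3 //|[//|[Eh|Eh]]]; exfalso; [apply: no31 | apply: no32].
    by rewrite -Eh.
  by rewrite -Eh.
have [m1 [m2 [m3 [m4 [? Em]]]]] : gens (f + g + n4 - h).
  case: (Hl n4) => [/h4 //|[//|[Eh|Eh]]]; exfalso; [apply: no42 | apply: no41].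
    by rewrite -Eh.
  by rewrite -Eh.
have [k1 [k2 [k3 [k4 [? Ek]]]]] := h1.
have [j1 [j2 [j3 [j4 [? Ej]]]]] := h2.
case: (Z_le_gt_dec l3 0) => ?; last first.
  by bad (as_F A) (k1 + 1 + l1) (k2 + l2) (k3 + l3 - 1) (k4 + l4).
case: (Z_le_gt_dec m4 0) => ?; last first.
  by bad (as_F A) (k1 + 1 + m1) (k2 + m2) (k3 + m3) (k4 + m4 - 1).
have [? ?]: l3 = 0 /\ m4 = 0 by lia. subst l3 m4.
have f34 : gens (f + n3 - n4).
  have [a [b [d [? Ef]]]] := row3 (as_f3 A) (not_gens_f (k := n3) A).
  case: (Z_le_gt_dec a 0) => ?; last by bad no31 (a - 1) b 0 d.
  have ?: a = 0 by lia. subst a.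
  case: (Z_le_gt_dec d l4) => ?; last by inH 0 b 0 (d - 1).
  case: (Z_le_gt_dec be b) => ?; first by bad no31 k1 (k2 + b - be) k3 (k4 + d).
  by bad (as_g A) l1 (be + l2 - b) 0 (l4 - d).
have g34 : gens (g + n3 - n4).
  have [a [b [d [? Eg]]]] := row3 (as_g3 A) (not_gens_f (k := n3) (almost_symC A)).
  case: (Z_le_gt_dec b 0) => ?; last by bad no32 a (b - 1) 0 d.
  have ?: b = 0 by lia. subst b.
  case: (Z_le_gt_dec d l4) => ?; last by inH a 0 0 (d - 1).
  case: (Z_le_gt_dec al a) => ?; first by bad no32 (j1 + a - al) j2 j3 (j4 + d).
  by bad (as_f A) (al + l1 - a) l2 0 (l4 - d).
have [a [b [c [? Ef]]]] := row4 (as_f4 A) (not_gens_f (k := n4) A).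
case: (Z_le_gt_dec b 0) => ?; last by bad no42 a (b - 1) c 0.
case: (Z_le_gt_dec c 0) => ?; last first.
  by apply: (excl A (p := n4) (q := n3)) => //; inH a b (c - 1) 0.
have [? ?]: b = 0 /\ c = 0 by lia. subst b c.
case: (Z_le_gt_dec al a) => ?; first by bad no42 (j1 + a - al) j2 j3 j4.
bad (as_g A) (al + m1 - a) m2 m3 0.
Qed.

End One.

Lemma no_one n1 n2 n3 n4 f g h al be :
  almost_sym n1 n2 n3 n4 f g -> cross n1 n2 n3 n4 f g h n1 n2 ->
  h = al * n1 -> h = be * n2 -> lowest n1 n2 n3 n4 al ->
  ~ gens n1 n2 n3 n4 (h - n3) -> ~ gens n1 n2 n3 n4 (h - n4) -> False.
Proof.
move=> A c12 ha hb low h3 h4.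
have [no1 no2] := cross_noF A c12.
have [x2 [t3 [t4 [? E]]]] := row1 (cr_F c12) no1.
case: (Z_le_gt_dec x2 0) => ?; last by bad no2 0 (x2 - 1) t3 t4.
have ?: x2 = 0 by lia. subst x2.
have on : one n1 n2 n3 n4 h al t3 t4 f g by constructor=> //; lia.
have no := oneC on.
have R x : gens n1 n2 n3 n4 x -> gens n1 n2 n4 n3 x by move/gens34.
have S x y : one n1 n2 n3 n4 h al t3 t4 x y -> one n1 n2 n4 n3 h al t4 t3 x y.
  by case=> *; constructor; [exact: almost_sym34 | exact: cross34 | lia].
have tp : 0 <= t3 /\ 0 <= t4 by lia.
case: (one_row ha hb low h3 tp on) => -[f2 g1];
case: (one_row ha hb low h3 tp no) => -[g2 f1].
- exact: (one_same on f2 g1 g2 f1).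
- exact: (one_mixed ha hb h3 h4 on f2 g1 g2 f1).
- exact: (one_mixed ha hb h3 h4 no g2 f1 f2 g1).
- by apply: (one_same (S _ _ on)); apply: R.
Qed.

(** * Two classes with mixed factorizations *)

Section TwoTwo.
Variables h : Z.

(** The letters x, y, s, t, primed or not, are the coefficients of n1, n2, n3, n4 in the four
    expressions of F. *)
Record twotwo (n1 n2 n3 n4 v1 v2 w3 w4 x x' y y' s s' t t' f g : Z) : Prop := TwoTwo {
  tt_A : almost_sym n1 n2 n3 n4 f g;
  tt_13 : cross n1 n2 n3 n4 f g h n1 n3;
  tt_14 : cross n1 n2 n3 n4 f g h n1 n4;
  tt_23 : cross n1 n2 n3 n4 f g h n2 n3;
  tt_24 : cross n1 n2 n3 n4 f g h n2 n4;
  tt_hv : h = v1 * n1 + v2 * n2;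
  tt_hw : h = w3 * n3 + w4 * n4;
  tt_vw : (1 <= v1 /\ 1 <= v2) /\ (1 <= w3 /\ 1 <= w4);
  tt_pos : ((0 <= x /\ 0 <= x') /\ (0 <= y /\ 0 <= y')) /\
           ((0 <= s /\ 0 <= s') /\ (0 <= t /\ 0 <= t'));
  tt_E13 : f + g = h - n1 - n3 + y * n2 + t * n4;
  tt_E14 : f + g = h - n1 - n4 + y' * n2 + s * n3;
  tt_E23 : f + g = h - n2 - n3 + x * n1 + t' * n4;
  tt_E24 : f + g = h - n2 - n4 + x' * n1 + s' * n3 }.

Section Fixed.
Variables n1 n2 n3 n4 v1 v2 w3 w4 x x' y y' s s' t t' : Z.
Local Notation gens := (gens n1 n2 n3 n4).
Local Notation twotwo := (twotwo n1 n2 n3 n4 v1 v2 w3 w4 x x' y y' s s' t t').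

Lemma twotwoC f g : twotwo f g -> twotwo g f.
Proof.
case=> A c13 c14 c23 c24 ? ? ? ? ? ? ? ?; constructor=> //;
  by [apply: almost_symC | apply: crossC | rewrite Z.add_comm].
Qed.

(** The sum of two opposite expressions (13 and 24, or 14 and 23) minus a third is again F. If one
    comparison failed, this would have nonnegative coefficients; the implications close up to a
    cycle in each direction. *)
Lemma twotwo_cycle f g : twotwo f g ->
  ((s' < s /\ x < x') /\ (t < t' /\ y' < y)) \/
  ((s < s' /\ x' < x) /\ (t' < t /\ y < y')) \/
  ((s' = s /\ x = x') /\ (t = t' /\ y' = y)).
Proof.
case=> A _ _ _ _ hv hw vw pos E13 E14 E23 E24.
have H1 : s' <= s -> x <= x'.
  move=> ?; case: (Z_le_gt_dec x x') => // ?.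
  by bad (as_F A) (x - x' - 1) y' (w3 + s - 1 - s') (w4 + t').
have H2 : x <= x' -> t <= t'.
  move=> ?; case: (Z_le_gt_dec t t') => // ?.
  by bad (as_F A) (v1 + x' - 1 - x) (v2 + y) s' (t - t' - 1).
have H3 : t <= t' -> y' <= y.
  move=> ?; case: (Z_le_gt_dec y' y) => // ?.
  by bad (as_F A) x (y' - y - 1) (w3 + s) (w4 + t' - 1 - t).
have H4 : y' <= y -> s' <= s.
  move=> ?; case: (Z_le_gt_dec s' s) => // ?.
  by bad (as_F A) (v1 + x') (v2 + y - 1 - y') (s' - s - 1) t.
have G1 : s <= s' -> y <= y'.
  move=> ?; case: (Z_le_gt_dec y y') => // ?.
  by bad (as_F A) x' (y - y' - 1) (w3 + s' - 1 - s) (w4 + t).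
have G2 : y <= y' -> t' <= t.
  move=> ?; case: (Z_le_gt_dec t' t) => // ?.
  by bad (as_F A) (v1 + x) (v2 + y' - 1 - y) s (t' - t - 1).
have G3 : t' <= t -> x' <= x.
  move=> ?; case: (Z_le_gt_dec x' x) => // ?.
  by bad (as_F A) (x' - x - 1) y (w3 + s') (w4 + t - 1 - t').
have G4 : x' <= x -> s <= s'.
  move=> ?; case: (Z_le_gt_dec s s') => // ?.
  by bad (as_F A) (v1 + x - 1 - x') (v2 + y') (s - s' - 1) t'.
lia.
Qed.

Lemma twotwo_equal f g : twotwo f g ->
  s' = s -> x = x' -> t = t' -> y' = y -> False.
Proof.
move=> tt es ex et ey; case: tt => A _ _ _ _ hv hw vw pos E13 E14 E23 E24.
have [b2 [b3 [b4 [? E]]]] := row1 (as_f1 A) (not_gens_f (k := n1) A).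
case: (Z_le_gt_dec b2 y) => ?; last by bad (as_f A) x (b2 - 1 - y) b3 b4.
have not_w c3 c4 : 0 <= c3 -> 0 <= c4 -> f + n1 = b2 * n2 + c3 * n3 + c4 * n4 ->
    w3 <= c3 -> w4 <= c4 -> False.
  by move=> *; bad (as_f A) (v1 - 1) (b2 + v2) (c3 - w3) (c4 - w4).
(* Equality gives (s + 1) n3 = (t + 1) n4. Trading along this relation moves the row until it lies
   below an expression of F, putting g in H, or contains w3 n3 + w4 n4, which [not_w] excludes. *)
have up (m : nat) : forall c3 c4, 0 <= c3 < Z.of_nat m -> 0 <= c4 < w4 ->
    f + n1 = b2 * n2 + c3 * n3 + c4 * n4 -> False.
  elim: m => [|m IH] c3 c4 ? ? Ec; first lia.
  case: (Z_le_gt_dec c3 (w3 + s)) => ?.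
    by bad (as_g A) 0 (y - b2) (w3 + s - c3) (w4 - 1 - c4).
  case: (Z_le_gt_dec w4 (c4 + 1 + t)) => ?.
    by apply: (not_w (c3 - 1 - s) (c4 + 1 + t)); lia.
  by apply: (IH (c3 - 1 - s) (c4 + 1 + t)); lia.
have down (m : nat) : forall c3 c4, 0 <= c4 < Z.of_nat m -> 0 <= c3 < w3 ->
    f + n1 = b2 * n2 + c3 * n3 + c4 * n4 -> False.
  elim: m => [|m IH] c3 c4 ? ? Ec; first lia.
  case: (Z_le_gt_dec c4 (w4 + t)) => ?.
    by bad (as_g A) 0 (y - b2) (w3 - 1 - c3) (w4 + t - c4).
  case: (Z_le_gt_dec w3 (c3 + 1 + s)) => ?.
    by apply: (not_w (c3 + 1 + s) (c4 - 1 - t)); lia.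
  by apply: (IH (c3 + 1 + s) (c4 - 1 - t)); lia.
case: (Z_le_gt_dec w4 b4) => ?.
  case: (Z_le_gt_dec w3 b3) => ?; first by apply: (not_w b3 b4); lia.
  by apply: (down (Z.to_nat b4).+1 b3 b4); lia.
by apply: (up (Z.to_nat b3).+1 b3 b4); lia.
Qed.

Hypothesis strict : (s' < s /\ x < x') /\ (t < t' /\ y' < y).

(** Differences of expressions of F give, for this and the next three lemmas, relations with
    nonnegative coefficients: (y + 1) n2 = (x + 1) n1 + (t' - t) n4, (x' + 1) n1 = (y' + 1) n2 + (s
    - s') n3, (s + 1) n3 = (y - y') n2 + (t + 1) n4, (t' + 1) n4 = (x' - x) n1 + (s' + 1) n3. *)
Lemma twotwo_row1 f g : twotwo f g ->
  (exists b2 b3 b4, [/\ 0 <= b2 /\ 0 <= b3 /\ 0 <= b4,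
     f + n1 = b2 * n2 + b3 * n3 + b4 * n4, w3 <= b3, 2 <= w4 &
     gens (f + n1 - n2)]) \/
  (gens (f + n1 - n4) /\ 2 <= w3).
Proof.
case=> A c13 c14 _ _ hv hw vw pos E13 E14 E23 E24.
have [b2 [b3 [b4 [? E]]]] := row1 (as_f1 A) (not_gens_f (k := n1) A).
case: (Z_le_gt_dec b2 y) => ?; last by bad (as_f A) x (b2 - 1 - y) b3 (b4 + t' - t).
case: (Z_le_gt_dec w4 b4) => ?.
  case: (Z_le_gt_dec (w3 - 1) b3) => ?; first by bad (cr_f c13) 0 b2 (b3 - w3 + 1) (b4 - w4).
  by right; split; [inH 0 b2 b3 (b4 - 1) | lia].
case: (Z_le_gt_dec w3 b3) => ?; last first.
  by bad (as_g A) 0 (y - b2) (w3 - 1 - b3) (w4 + t - b4).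
case: (Z_le_gt_dec (w4 - 1) b4) => ?; first by bad (cr_f c14) 0 b2 (b3 - w3) (b4 - w4 + 1).
left; exists b2, b3, b4; split=> //; try lia.
case: (Z_le_gt_dec b2 0) => ?; last by inH 0 (b2 - 1) b3 b4.
case: (Z_le_gt_dec b3 (w3 + s)) => ?.
  by bad (as_g A) 0 (y' - b2) (w3 + s - b3) (w4 - 1 - b4).
inH 0 (b2 - 1 + y - y') (b3 - 1 - s) (b4 + 1 + t).
Qed.

Lemma twotwo_row2 f g : twotwo f g ->
  gens (f + n2 - n3) \/
  (exists d1 d3 d4, [/\ 0 <= d1 /\ 0 <= d3 /\ 0 <= d4,
     f + n2 = d1 * n1 + d3 * n3 + d4 * n4, w4 <= d4, 2 <= w3 &
     gens (f + n2 - n1)]).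
Proof.
case=> A _ _ c23 c24 hv hw vw pos E13 E14 E23 E24.
have [d1 [d3 [d4 [? E]]]] := row2 (as_f2 A) (not_gens_f (k := n2) A).
case: (Z_le_gt_dec d1 x') => ?; last by bad (as_f A) (d1 - 1 - x') y' (d3 + s - s') d4.
case: (Z_le_gt_dec w3 d3) => ?; first by left; inH d1 0 (d3 - 1) d4.
case: (Z_le_gt_dec w4 d4) => ?; last first.
  by bad (as_g A) (x' - d1) 0 (w3 + s' - d3) (w4 - 1 - d4).
case: (Z_le_gt_dec (w3 - 1) d3) => ?; first by bad (cr_f c23) d1 0 (d3 - w3 + 1) (d4 - w4).
right; exists d1, d3, d4; split=> //; try lia.
case: (Z_le_gt_dec d1 0) => ?; last by inH (d1 - 1) 0 d3 d4.
case: (Z_le_gt_dec d4 (w4 + t')) => ?.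
  by bad (as_g A) (x - d1) 0 (w3 - 1 - d3) (w4 + t' - d4).
inH (d1 + x' - x - 1) 0 (d3 + 1 + s') (d4 - 1 - t').
Qed.

Lemma twotwo_row3 f g : twotwo f g ->
  gens (f + n3 - n1) \/ (gens (f + n3 - n2) /\ gens (f + n3 - n4)).
Proof.
case=> A _ _ _ _ hv hw vw pos E13 E14 E23 E24.
have [c1 [c2 [c4 [? E]]]] := row3 (as_f3 A) (not_gens_f (k := n3) A).
case: (Z_le_gt_dec c4 t') => ?; last by bad (as_f A) (c1 + x' - x) c2 s' (c4 - 1 - t').
case: (Z_le_gt_dec v1 c1) => ?; first by left; inH (c1 - 1) c2 0 c4.
case: (Z_le_gt_dec v2 c2) => ?; last first.
  by bad (as_g A) (v1 + x - c1) (v2 - 1 - c2) 0 (t' - c4).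
right; split; first by inH c1 (c2 - 1) 0 c4.
case: (Z_le_gt_dec c4 0) => ?; last by inH c1 c2 0 (c4 - 1).
case: (Z_le_gt_dec c2 (v2 + y)) => ?.
  by bad (as_g A) (v1 - 1 - c1) (v2 + y - c2) 0 (t - c4).
inH (c1 + 1 + x) (c2 - 1 - y) 0 (c4 + t' - t - 1).
Qed.

Lemma twotwo_row4 f g : twotwo f g ->
  gens (f + n4 - n2) \/ (gens (f + n4 - n1) /\ gens (f + n4 - n3)).
Proof.
case=> A _ _ _ _ hv hw vw pos E13 E14 E23 E24.
have [e1 [e2 [e3 [? E]]]] := row4 (as_f4 A) (not_gens_f (k := n4) A).
case: (Z_le_gt_dec e3 s) => ?; last by bad (as_f A) e1 (e2 + y - y') (e3 - 1 - s) t.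
case: (Z_le_gt_dec v2 e2) => ?; first by left; inH e1 (e2 - 1) e3 0.
case: (Z_le_gt_dec v1 e1) => ?; last first.
  by bad (as_g A) (v1 - 1 - e1) (v2 + y' - e2) (s - e3) 0.
right; split; first by inH (e1 - 1) e2 e3 0.
case: (Z_le_gt_dec e3 0) => ?; last by inH e1 e2 (e3 - 1) 0.
case: (Z_le_gt_dec e1 (v1 + x')) => ?.
  by bad (as_g A) (v1 + x' - e1) (v2 - 1 - e2) (s' - e3) 0.
inH (e1 - 1 - x') (e2 + 1 + y') (e3 + s - s' - 1) 0.
Qed.

Lemma twotwo_same12 f g : twotwo f g ->
  gens (g + n3 - n1) -> gens (g + n2 - n3) -> gens (f + n1 - n2).
Proof.
case=> A _ _ _ _ hv hw vw pos E13 E14 E23 E24 g31 g23.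
have [b2 [b3 [b4 [? E1]]]] := row1 (as_f1 A) (not_gens_f (k := n1) A).
have [c1 [c2 [c4 [? E3]]]] := row3 (as_f3 A) (not_gens_f (k := n3) A).
case: (Z_le_gt_dec b2 0) => ?; last by inH 0 (b2 - 1) b3 b4.
case: (Z_le_gt_dec b3 0) => ?; last first.
  by exfalso; apply: (excl A (p := n1) (q := n3)) => //; inH 0 b2 (b3 - 1) b4.
case: (Z_le_gt_dec c2 0) => ?; last first.
  by exfalso; apply: (excl A (p := n3) (q := n2)) => //; inH c1 (c2 - 1) 0 c4.
have [? [? ?]]: b2 = 0 /\ b3 = 0 /\ c2 = 0 by lia. subst b2 b3 c2.
(* With f + n1 = b4 n4 and f + n3 = c1 n1 + c4 n4, subtraction gives n3 + (b4 - c4) n4 = (1 + c1)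
   n1; inserted into the expression for 2, 4 it makes F nonnegative. *)
case: (Z_le_gt_dec b4 c4) => ?.
  by exfalso; apply: (as_min3 A (b := 1 + c1) (c := 0) (d := c4 - b4)); lia.
case: (Z_le_gt_dec c1 x') => ?; last first.
  by bad (as_f A) (c1 - 1 - x') (1 + y') (s - s' - 1) c4.
by bad (as_F A) (v1 + x' - 1 - c1) (v2 - 1) (s' + 1) (b4 - c4 - 1).
Qed.

Lemma twotwo_same f g : twotwo f g ->
  gens (f + n3 - n1) -> gens (f + n2 - n3) -> gens (f + n4 - n2) ->
  gens (g + n3 - n1) -> gens (g + n2 - n3) -> gens (g + n4 - n2) -> False.
Proof.
move=> tt f31 f23 f42 g31 g23 g42.
have f12 := twotwo_same12 tt g31 g23.
have g12 := twotwo_same12 (twotwoC tt) f31 f23.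
case: tt => A _ _ _ _ _ _ _ _ _ _ _ _.
have R u v : almost_sym n1 n2 n3 n4 u v -> gens (v + n1 - n2) ->
    gens (v + n4 - n2) -> exists d, u + n2 = d * n3.
  move=> Au v12 v42.
  have [d1 [d3 [d4 [? E]]]] := row2 (as_f2 Au) (not_gens_f (k := n2) Au).
  case: (Z_le_gt_dec d1 0) => ?; last first.
    by exfalso; apply: (excl Au (p := n2) (q := n1)) => //; inH (d1 - 1) 0 d3 d4.
  case: (Z_le_gt_dec d4 0) => ?; last first.
    by exfalso; apply: (excl Au (p := n2) (q := n4)) => //; inH d1 0 d3 (d4 - 1).
  have [? ?]: d1 = 0 /\ d4 = 0 by lia. subst d1 d4.
  by exists d3; lia.
have [d E] := R _ _ A g12 g42.
have [d' E'] := R _ _ (almost_symC A) f12 f42.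
apply: (no_multiple A (k := n3) (c := d) (d := d')); last lia.
exact: gens3.
Qed.

(* Here the exclusions leave the rows
   f = (-1,b2,b3,0) = (d1,-1,0,d4) = (c1,0,-1,0) = (0,e2,0,-1) and
   g = (-1,0,0,g4) = (0,-1,g3,0) = (0,h2,-1,h4) = (k1,0,k3,-1). *)
Lemma twotwo_mixed f g : twotwo f g ->
  (exists b2 b3 b4, [/\ 0 <= b2 /\ 0 <= b3 /\ 0 <= b4,
     f + n1 = b2 * n2 + b3 * n3 + b4 * n4, w3 <= b3, 2 <= w4 &
     gens (f + n1 - n2)]) ->
  (exists d1 d3 d4, [/\ 0 <= d1 /\ 0 <= d3 /\ 0 <= d4,
     f + n2 = d1 * n1 + d3 * n3 + d4 * n4, w4 <= d4, 2 <= w3 &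
     gens (f + n2 - n1)]) ->
  gens (f + n3 - n1) -> gens (f + n4 - n2) ->
  gens (g + n1 - n4) -> gens (g + n2 - n3) ->
  gens (g + n3 - n2) -> gens (g + n3 - n4) ->
  gens (g + n4 - n1) -> gens (g + n4 - n3) -> False.
Proof.
case=> A c13 _ _ _ hv hw vw _ _ _ _ _.
move=> [b2 [b3 [b4 [? E1 ? ? f12]]]] [d1 [d3 [d4 [? E2 ? ? f21]]]].
move=> f31 f42 g14 g23 g32 g34 g41 g43.
have f13 : gens (f + n1 - n3) by inH 0 b2 (b3 - 1) b4.
have f24 : gens (f + n2 - n4) by inH d1 0 d3 (d4 - 1).
have no p q : gens (g + q - p) -> ~ gens (f + p - q).
  by move=> gq fp; apply: (excl A fp gq).
have no' p q : gens (f + q - p) -> ~ gens (g + p - q).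
  by move=> fq gp; apply: (excl A fq gp).
case: (Z_le_gt_dec b4 0) => ?; last by bad (no _ _ g41) 0 b2 b3 (b4 - 1).
case: (Z_le_gt_dec d3 0) => ?; last by bad (no _ _ g32) d1 0 (d3 - 1) d4.
have [? ?]: b4 = 0 /\ d3 = 0 by lia. subst b4 d3.
case: (f31) => c1 [c2 [c3 [c4 [? E3]]]].
case: (Z_le_gt_dec c2 0) => ?; last by bad (no _ _ g23) (c1 + 1) (c2 - 1) c3 c4.
case: (Z_le_gt_dec c3 0) => ?; last by bad (as_f A) (c1 + 1) c2 (c3 - 1) c4.
case: (Z_le_gt_dec c4 0) => ?; last by bad (no _ _ g43) (c1 + 1) c2 c3 (c4 - 1).
have [? [? ?]]: c2 = 0 /\ c3 = 0 /\ c4 = 0 by lia. subst c2 c3 c4.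
case: (f42) => e1 [e2 [e3 [e4 [? E4]]]].
case: (Z_le_gt_dec e1 0) => ?; last by bad (no _ _ g14) (e1 - 1) (e2 + 1) e3 e4.
case: (Z_le_gt_dec e3 0) => ?; last by bad (no _ _ g34) e1 (e2 + 1) (e3 - 1) e4.
case: (Z_le_gt_dec e4 0) => ?; last by bad (as_f A) e1 (e2 + 1) e3 (e4 - 1).
have [? [? ?]]: e1 = 0 /\ e3 = 0 /\ e4 = 0 by lia. subst e1 e3 e4.
have [a2 [a3 [g4 [? G1]]]] := row1 (as_g1 A) (not_gens_f (k := n1) (almost_symC A)).
case: (Z_le_gt_dec a2 0) => ?; last by bad (no' _ _ f21) 0 (a2 - 1) a3 g4.
case: (Z_le_gt_dec a3 0) => ?; last by bad (no' _ _ f31) 0 a2 (a3 - 1) g4.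
have [? ?]: a2 = 0 /\ a3 = 0 by lia. subst a2 a3.
have [a1 [g3 [a4 [? G2]]]] := row2 (as_g2 A) (not_gens_f (k := n2) (almost_symC A)).
case: (Z_le_gt_dec a1 0) => ?; last by bad (no' _ _ f12) (a1 - 1) 0 g3 a4.
case: (Z_le_gt_dec a4 0) => ?; last by bad (no' _ _ f42) a1 0 g3 (a4 - 1).
have [? ?]: a1 = 0 /\ a4 = 0 by lia. subst a1 a4.
have [a1 [h2 [h4 [? G3]]]] := row3 (as_g3 A) (not_gens_f (k := n3) (almost_symC A)).
case: (Z_le_gt_dec a1 0) => ?; last by bad (no' _ _ f13) (a1 - 1) h2 0 h4.
have ?: a1 = 0 by lia. subst a1.
case: (g43) => k1 [k2 [k3 [k4 [? G4]]]].
case: (Z_le_gt_dec k2 0) => ?; last by bad (no' _ _ f24) k1 (k2 - 1) (k3 + 1) k4.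
case: (Z_le_gt_dec k4 0) => ?; last by bad (as_g A) k1 k2 (k3 + 1) (k4 - 1).
have [? ?]: k2 = 0 /\ k4 = 0 by lia. subst k2 k4.
(* n1 + h2 n2 = n3 + (g4 - h4) n4 and n2 + k1 n1 = (g3 - 1 - k3) n3 + n4 *)
case: (Z_le_gt_dec g4 h4) => ?.
  by apply: (as_min3 A (b := 1) (c := h2) (d := h4 - g4)); lia.
case: (Z_le_gt_dec g3 (k3 + 1)) => ?.
  by apply: (as_min4 A (b := k1) (c := 1) (d := k3 + 1 - g3)); lia.
case: (Z_le_gt_dec (g4 - h4) 1) => ?.
  by have ? : g4 = h4 + 1 by [lia]; subst g4; bad (cr_pq c13) 0 h2 (w3 - 2) (w4 - 1).
case: (Z_le_gt_dec (g3 - k3 - 1) 1) => ?.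
  have ? : g3 = k3 + 2 by [lia]. subst g3.
  case: (Z_le_gt_dec k1 0) => ?.
    have ?: k1 = 0 by lia. subst k1.
    by apply: (as_min2 A (b := 0) (c := 1) (d := 1)); lia.
  by bad (cr_pq c13) (k1 - 1) 1 (w3 - 2) (w4 - 1).
(* In this and the next three steps F is a row of f plus a row of g, corrected by differences of
   rows of f or of g until all coefficients are nonnegative. *)
case: (Z_le_gt_dec (e2 + 1 - b2) h2) => ?.
  by bad (as_F A) c1 (h2 - (e2 + 1 - b2)) (b3 - 2) (h4 + 1).
case: (Z_le_gt_dec (c1 + 1 - d1) k1) => ?.
  by bad (as_F A) (k1 - (c1 + 1 - d1)) e2 (k3 + 2) (d4 - 2).
case: (Z_le_gt_dec (b3 - 1) g3) => ?.
  by bad (as_F A) 0 (e2 + (e2 + 1 - b2) - h2) (g3 - b3 + 1) (g4 - h4 - 2).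
case: (Z_le_gt_dec (d4 - 1) g4) => ?.
  by bad (as_F A) (c1 + (c1 + 1 - d1 - k1)) 0 (g3 - k3 - 3) (g4 - d4 + 1).
(* Rows 1 and 4 of g give (g4 + 1) n4 = (k1 + 1) n1 + (k3 + 1) n3, which brings n3 into f + n2. *)
by bad (no _ _ g32) (d1 + k1 + 1) 0 k3 (d4 - g4 - 1).
Qed.

(** [M] shows that the first alternative of [twotwo_row1] survives the exclusions only in the
    situation of [twotwo_mixed]. Otherwise f and g have the same pattern of positive entries and
    [twotwo_same] applies. *)
Lemma twotwo_strict f g : twotwo f g -> False.
Proof.
move=> tt; have tt' := twotwoC tt; have A := tt_A tt; have B := tt_A tt'.
have fx p q : gens (f + p - q) -> gens (g + q - p) -> False by apply: (@excl _ _ _ _ _ _ A p q).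
have gx p q : gens (g + p - q) -> gens (f + q - p) -> False by apply: (@excl _ _ _ _ _ _ B p q).
have p13 u v : twotwo u v -> (exists b2 b3 b4, [/\ 0 <= b2 /\ 0 <= b3 /\ 0 <= b4,
     u + n1 = b2 * n2 + b3 * n3 + b4 * n4, w3 <= b3, 2 <= w4 &
     gens (u + n1 - n2)]) -> gens (u + n1 - n2) /\ gens (u + n1 - n3).
  case=> _ _ _ _ _ _ _ vw _ _ _ _ _ [b2 [b3 [b4 [? E ? ? ?]]]]; split=> //.
  by inH 0 b2 (b3 - 1) b4.
have p24 u v : twotwo u v -> (exists d1 d3 d4, [/\ 0 <= d1 /\ 0 <= d3 /\ 0 <= d4,
     u + n2 = d1 * n1 + d3 * n3 + d4 * n4, w4 <= d4, 2 <= w3 &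
     gens (u + n2 - n1)]) -> gens (u + n2 - n1) /\ gens (u + n2 - n4).
  case=> _ _ _ _ _ _ _ vw _ _ _ _ _ [d1 [d3 [d4 [? E ? ? ?]]]]; split=> //.
  by inH d1 0 d3 (d4 - 1).
have M u v : twotwo u v -> (forall p q, gens (u + p - q) -> gens (v + q - p) -> False) ->
  (exists b2 b3 b4, [/\ 0 <= b2 /\ 0 <= b3 /\ 0 <= b4,
     u + n1 = b2 * n2 + b3 * n3 + b4 * n4, w3 <= b3, 2 <= w4 &
     gens (u + n1 - n2)]) -> False.
  move=> T X R1; have [u12 u13] := p13 _ _ T R1.
  case: (twotwo_row3 (twotwoC T)) => [v31|[v32 v34]]; first exact: X u13 v31.
  case: (twotwo_row2 (twotwoC T)) => [v23|R2']; last first.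
    by have [v21 _] := p24 _ _ (twotwoC T) R2'; exact: X u12 v21.
  case: (twotwo_row2 T) => [u23|R2]; first exact: X u23 v32.
  have [u21 u24] := p24 _ _ T R2.
  case: (twotwo_row4 (twotwoC T)) => [v42|[v41 v43]]; first exact: X u24 v42.
  case: (twotwo_row4 T) => [u42|[u41 u43]]; last exact: X u43 v34.
  case: (twotwo_row1 (twotwoC T)) => [R1'|[v14 _]].
    by have [v12 _] := p13 _ _ (twotwoC T) R1'; exact: X u21 v12.
  case: (twotwo_row3 T) => [u31|[_ u34]]; last exact: X u34 v43.
  exact: (twotwo_mixed T R1 R2 u31 u42 v14 v23 v32 v34 v41 v43).
case: (twotwo_row1 tt) => [R1|[f14 _]]; first exact: (M _ _ tt fx R1).
case: (twotwo_row1 tt') => [R1|[g14 _]]; first exact: (M _ _ tt' gx R1).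
case: (twotwo_row4 tt) => [f42|[f41 _]]; last exact: gx g14 f41.
case: (twotwo_row4 tt') => [g42|[g41 _]]; last exact: fx f14 g41.
case: (twotwo_row2 tt) => [f23|R2]; last first.
  by have [_ f24] := p24 _ _ tt R2; exact: fx f24 g42.
case: (twotwo_row2 tt') => [g23|R2]; last first.
  by have [_ g24] := p24 _ _ tt' R2; exact: gx g24 f42.
case: (twotwo_row3 tt) => [f31|[f32 _]]; last exact: gx g23 f32.
case: (twotwo_row3 tt') => [g31|[g32 _]]; last exact: fx f23 g32.
exact: (twotwo_same tt f31 f23 f42 g31 g23 g42).
Qed.

End Fixed.
End TwoTwo.

Lemma no_twotwo n1 n2 n3 n4 f g h v1 v2 w3 w4 :
  almost_sym n1 n2 n3 n4 f g ->
  cross n1 n2 n3 n4 f g h n1 n3 -> cross n1 n2 n3 n4 f g h n1 n4 ->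
  cross n1 n2 n3 n4 f g h n2 n3 -> cross n1 n2 n3 n4 f g h n2 n4 ->
  h = v1 * n1 + v2 * n2 -> h = w3 * n3 + w4 * n4 ->
  1 <= v1 -> 1 <= v2 -> 1 <= w3 -> 1 <= w4 -> False.
Proof.
move=> A c13 c14 c23 c24 hv hw ? ? ? ?.
have [no1 no3] := cross_noF A c13.
have [x2 [x3 [x4 [? E13]]]] := row1 (cr_F c13) no1.
case: (Z_le_gt_dec x3 0) => ?; last by bad no3 0 x2 (x3 - 1) x4.
have {no1 no3} [no1 no4] := cross_noF A c14.
have [y2 [y3 [y4 [? E14]]]] := row1 (cr_F c14) no1.
case: (Z_le_gt_dec y4 0) => ?; last by bad no4 0 y2 y3 (y4 - 1).
have {no1 no4} [no2 no3] := cross_noF A c23.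
have [z1 [z3 [z4 [? E23]]]] := row2 (cr_F c23) no2.
case: (Z_le_gt_dec z3 0) => ?; last by bad no3 z1 0 (z3 - 1) z4.
have {no2 no3} [no2 no4] := cross_noF A c24.
have [t1 [t3 [t4 [? E24]]]] := row2 (cr_F c24) no2.
case: (Z_le_gt_dec t4 0) => ?; last by bad no4 t1 0 t3 (t4 - 1).
have [? [? [? ?]]]: x3 = 0 /\ y4 = 0 /\ z3 = 0 /\ t4 = 0 by lia. subst x3 y4 z3 t4.
have tt : twotwo h n1 n2 n3 n4 v1 v2 w3 w4 z1 t1 x2 y2 y3 t3 x4 z4 f g.
  by constructor=> //; lia.
case: (twotwo_cycle tt) => [st|[st|[[? ?] [? ?]]]]; last exact: (twotwo_equal tt).
  exact: (twotwo_strict st tt).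
(* Exchanging 3 and 4 reverses all four strict inequalities. *)
have tt' : twotwo h n1 n2 n4 n3 v1 v2 w4 w3 t1 z1 y2 x2 x4 z4 y3 t3 f g.
  by constructor=> //; [exact: almost_sym34 | exact: cross34 | exact: cross34
    | exact: cross34 | exact: cross34 | lia..].
by apply: (twotwo_strict _ tt'); lia.
Qed.

Local Close Scope Z_scope.

(** * Pseudo-Frobenius numbers of almost symmetric semigroups *)

Lemma bigmax_mem (s : seq nat) m : m \in s -> (\max_(x <- s) x)%N \in s.
Proof.
elim: s m => [//|a s IH] m _; rewrite big_cons inE.
case: s IH => [|b s] IH; first by rewrite big_nil maxn0 eqxx.
by rewrite /maxn; case: ifP => _; rewrite ?eqxx ?(IH b) ?orbT ?mem_head.
Qed.

Section PseudoFrobenius.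
Variables (k : nat) (n : 'I_k -> nat) (H : set nat).
Hypotheses (k_gt1 : (1 < k)%N) (semiH : numerical_semigroup H).
Hypotheses (properH : H <> [set: nat]%classic) (genH : minimally_generated n H).
Local Notation F := (Frobenius H).

Lemma semigroup0 : H 0%N. Proof. by case: semiH. Qed.

Lemma semigroupD a b : H a -> H b -> H (a + b)%N.
Proof. by case: semiH => _ + _; apply. Qed.

Lemma semigroupP m :
  H m <-> exists c : 'I_k -> nat, m = (\sum_i c i * n i)%N.
Proof.
have span c : (\sum_(i in [set: 'I_k]%SET) c i * n i = \sum_i c i * n i)%N.
  by apply: eq_bigl => i; rewrite inE.
case: genH => HE _; split=> [|[c ->]].
  by rewrite {1}HE => -[c ->]; exists c; rewrite span.
by rewrite HE; exists c; rewrite span.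
Qed.

Lemma gen_notin_span j (c : 'I_k -> nat) :
  n j <> (\sum_(i | i != j) c i * n i)%N.
Proof.
move=> nj; case: genH => _ /(_ [set~ j]%SET) [].
  rewrite properE finset.subsetT /=; apply/subsetPn.
  by exists j; rewrite ?inE ?eqxx.
apply/seteqP; split=> [m|m].
  move/semigroupP=> [d ->]; exists (fun i => d i + d j * c i)%N.
  rewrite (bigD1 j) //= nj big_distrr -big_split /=.
  apply: eq_big => [i|i _]; first by rewrite !inE.
  by rewrite mulnDl mulnA addnC.
move=> [d ->]; apply/semigroupP; exists (fun i => if i == j then 0 else d i)%N.
rewrite [RHS](bigD1 j) //= eqxx mul0n add0n.
apply: eq_big => [i|i]; first by rewrite !inE.
by rewrite !inE => /negbTE ->.
Qed.

Lemma gen_gt0 j : (0 < n j)%N.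
Proof.
rewrite lt0n; apply/eqP => nj0; apply: (@gen_notin_span j (fun=> 0%N)).
by rewrite nj0 big1 // => i _; rewrite mul0n.
Qed.

Lemma semigroup_decomp m : H m -> (0 < m)%N ->
  exists i, (n i <= m)%N /\ H (m - n i)%N.
Proof.
move/semigroupP=> [c ->]; rewrite lt0n sum_nat_eq0 negb_forall.
case/existsP=> i; rewrite /= muln_eq0 negb_or => /andP[ci _].
have [d ed] : exists d, c i = d.+1 by exists (c i).-1; rewrite prednK ?lt0n.
exists i; rewrite (bigD1 i) //= ed mulSn -addnA leq_addr addKn; split=> //.
apply/semigroupP; exists (fun j => if j == i then d else c j).
rewrite [RHS](bigD1 i) //= eqxx; congr (_ + _)%N.
by apply: eq_bigr => j /negbTE ->.
Qed.

Lemma gap_le m : ~ H m -> (m <= F)%N.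
Proof.
move=> Hm; rewrite /Frobenius; apply: leq_bigmax_seq => //.
by case: semiH => _ _ finH; rewrite in_fset_set // in_setE.
Qed.

Lemma Frobenius_gap : ~ H F.
Proof.
have finG : finite_set (~` H)%classic by case: semiH.
have [m Hm] : exists m, ~ H m.
  apply: contrapT => no; apply: properH; apply/seteqP; split=> // m _.
  by apply: contrapT => Hm; apply: no; exists m.
suff : F \in fset_set (~` H)%classic by rewrite in_fset_set // in_setE.
have : m \in fset_set (~` H)%classic by rewrite in_fset_set // in_setE.
exact: bigmax_mem.
Qed.

Lemma gt_Frobenius m : (F < m)%N -> H m.
Proof. by move=> Fm; apply: contrapT => /gap_le; rewrite leqNgt Fm. Qed.

(** A negative pseudo-Frobenius number plus the smallest generator is an element of H below that
    generator, hence 0. Adding it to a second generator would then express that generator by the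
    others. *)
Lemma PF_nat f : PF n H f -> exists p : nat, f = Posz p.
Proof.
case: f => [p _|p [_ Hp]]; first by exists p.
pose i0 : 'I_k := Ordinal (ltnW k_gt1).
have [i _ imin] := @arg_minnP _ i0 xpredT n isT.
have [h Hh eh] := Hp i.
have h0 : h = 0%N.
  apply/eqP; rewrite -leqn0 leqNgt; apply/negP => /(semigroup_decomp Hh) [j [jh _]].
  by have := imin j isT; lia.
have [j ji] : exists j, j != i.
  case: (eqVneq i i0) => [->|]; last by exists i0; rewrite eq_sym.
  by exists (Ordinal k_gt1).
have [g /semigroupP [c ec] eg] := Hp j.
have := @gen_notin_span j (fun l => c l + (l == i))%N.
case: (posnP (c j)) => cj; last first.
  have : (c j * n j <= g)%N by rewrite ec (bigD1 j) //= leq_addr.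
  have : (n j <= c j * n j)%N by rewrite leq_pmull.
  by lia.
case; under eq_bigr do rewrite mulnDl.
rewrite big_split /= [X in (_ + X)%N](bigD1 i) 1?eq_sym //= eqxx mul1n.
rewrite [X in (_ + (_ + X))%N]big1 => [|l /andP[_ /negbTE ->]]; last by rewrite mul0n.
have -> : (\sum_(l | l != j) c l * n l = g)%N.
  by rewrite ec [RHS](bigD1 j) //= cj mul0n.
by lia.
Qed.

Lemma PF_add p h : PF n H (Posz p) -> H h -> (0 < h)%N -> H (p + h)%N.
Proof.
move=> [_ Hp] Hh /(semigroup_decomp Hh) [i [ih Hi]].
have [q Hq /= eq] := Hp i.
have -> : (p + h = q + (h - n i))%N by lia.
exact: semigroupD.
Qed.

Lemma PF_Frobenius : PF n H (Posz F).
Proof.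
split=> [[h Hh [e]]|i]; first by apply: Frobenius_gap; rewrite -e.
exists (F + n i)%N => //; apply: gt_Frobenius.
by rewrite -[X in (X < _)%N]addn0 ltn_add2l gen_gt0.
Qed.

Lemma in_intP m : in_int H (Posz m) <-> H m.
Proof. by split=> [[h Hh [<-]]|Hm] //; exists m. Qed.

Lemma card_fset_set_map (T : choiceType) (A : set T) (B : {set 'I_F.+1})
    (g : 'I_F.+1 -> T) : injective g ->
  (forall x, A x <-> exists2 i, i \in B & x = g i) -> #|` fset_set A| = #|B|.
Proof.
move=> inj_g AP.
have AE : A = [set` [seq g i | i in B]]%classic.
  apply/seteqP; split=> x /=.
    by move/AP=> [i iB ->]; apply: map_f; rewrite mem_enum.
  by case/mapP => i; rewrite mem_enum => iB ->; apply/AP; exists i.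
have finA : finite_set A by rewrite AE; apply: finite_seq.
rewrite cardE -(size_map g); apply: perm_size; apply: uniq_perm.
- exact: fset_uniq.
- by rewrite map_inj_uniq ?enum_uniq.
by move=> x; rewrite in_fset_set // AE; apply/idP/idP; rewrite in_setE.
Qed.

Local Notation gaps := [set x : 'I_F.+1 | `[< ~ H x >]]%SET.
Local Notation duals := [set x : 'I_F.+1 | `[< H (F - x)%N >]]%SET.
Local Notation PFs := [set x : 'I_F.+1 | `[< PF n H (Posz x) >]]%SET.

Lemma card_gaps : #|` fset_set (~` H)%classic| = #|gaps|.
Proof.
apply: (card_fset_set_map (g := val)); first exact: val_inj.
move=> x; split=> [Hx|[i]]; last by rewrite inE => /asboolP + ->.
have xF : (x < F.+1)%N by rewrite ltnS gap_le.
by exists (Ordinal xF); rewrite ?inE //=; apply/asboolP.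
Qed.

Lemma card_PFs : semigroup_type n H = #|PFs|.
Proof.
apply: (card_fset_set_map (g := fun i : 'I_F.+1 => Posz i)).
  by move=> i j [] /val_inj.
move=> x; split=> [Px|[i]]; last by rewrite inE => /asboolP + ->.
have [p ep] := PF_nat Px; have pF : (p < F.+1)%N.
  by rewrite ltnS gap_le // => Hp; case: Px => + _; rewrite ep => /in_intP.
by exists (Ordinal pF); rewrite ?inE //=; apply/asboolP; rewrite -ep.
Qed.

Lemma card_duals : #|duals| = (F.+1 - #|gaps|)%N.
Proof.
have -> : duals = (@rev_ord F.+1 @: ~: gaps)%SET.
  apply/setP => x; apply/idP/imsetP => [|[y]]; rewrite !inE.
    move=> /asboolP Hx; exists (rev_ord x); last by rewrite rev_ordK.
    by rewrite !inE; apply/asboolP => /=; rewrite subSS.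
  move=> /asboolP/contrapT Hy ->; apply/asboolP => /=.
  by rewrite subSS subKn // -ltnS.
rewrite card_imset; last exact: rev_ord_inj.
by rewrite cardsCs finset.setCK card_ord.
Qed.

Hypothesis almostH : almost_symmetric n H.

(** The duals are gaps, because F is one, and there are F + 1 - |gaps| of them. By almost symmetry
    the right side has 2 |gaps| - F - 1 = type - 1 elements, and it contains PF'. *)
Lemma PFs_gaps : (PFs :\ ord_max = gaps :\: duals)%SET.
Proof.
have sub : (duals \subset gaps)%SET.
  apply/fintype.subsetP => x; rewrite !inE => /asboolP Hx; apply/asboolP => Hx'.
  by apply: Frobenius_gap; have := semigroupD Hx' Hx; rewrite subnKC // -ltnS.
apply/eqP; rewrite eqEcard; apply/andP; split.
  apply/fintype.subsetP => x; rewrite !inE => /andP[xF /asboolP Px].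
  apply/andP; split; apply/asboolP; last by case: Px => + _ Hx; case; exists (x : nat).
  move=> Hx; have xF' : (x < F)%N.
    by rewrite ltn_neqAle -ltnS ltn_ord andbT; apply: contra xF => /eqP e; apply/eqP/val_inj.
  apply: Frobenius_gap; have := PF_add Px Hx; rewrite subn_gt0 => /(_ xF').
  by rewrite subnKC // ltnW.
rewrite cardsD (finset.setIidPr sub) card_duals.
have : ord_max \in PFs by rewrite inE; apply/asboolP; exact: PF_Frobenius.
move=> maxP.
have := almostH; rewrite /almost_symmetric card_gaps card_PFs (cardsD1 ord_max PFs) maxP.
have : (#|gaps| <= F.+1)%N by rewrite -[X in (_ <= X)%N]card_ord max_card.
by lia.
Qed.

Lemma PF_type3 : semigroup_type n H = 3 -> exists f g : nat,
  [/\ f <> g, (f + g = F)%N, PF' n H (Posz f) /\ PF' n H (Posz g),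
      ~ H f /\ ~ H g &
      forall x, [\/ H x, (x <= F)%N /\ H (F - x)%N, x = f | x = g]].
Proof.
move=> type3.
have : #|PFs :\ ord_max| = 2%N.
  have : ord_max \in PFs by rewrite inE; apply/asboolP; exact: PF_Frobenius.
  by move=> maxP; have := card_PFs; rewrite type3 (cardsD1 ord_max PFs) maxP => -[].
move=> /eqP/cards2P [f [g [fg PFE]]].
have mem x : (x \in gaps :\: duals)%SET = (x == f) || (x == g).
  by rewrite -PFs_gaps PFE !inE.
have revD x : (x \in gaps :\: duals)%SET -> (rev_ord x \in gaps :\: duals)%SET.
  rewrite !inE => /andP[/asboolP Hx /asboolP Hx']; apply/andP; split; apply/asboolP => /=.
    by rewrite subSS subKn // -ltnS.
  by rewrite subSS.
have PFx x : x \in PFs :\ ord_max -> PF' n H (Posz x) /\ ~ H x.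
  rewrite !inE => /andP[xF /asboolP Px]; split.
    split=> // -[e]; case/eqP: xF; exact: val_inj.
  by case: Px => + _ Hx; case; exists (x : nat).
have [Pf Hf] : PF' n H (Posz f) /\ ~ H f by apply: PFx; rewrite PFE !inE eqxx.
have [Pg Hg] : PF' n H (Posz g) /\ ~ H g by apply: PFx; rewrite PFE !inE eqxx orbT.
have sumF : rev_ord f = g.
  have := revD f; rewrite !mem eqxx /= => /(_ isT) /orP[/eqP ff|/eqP //].
  have := revD g; rewrite !mem eqxx orbT => /(_ isT) /orP[/eqP gf|/eqP gg].
    by rewrite -gf rev_ordK.
  have ef := congr1 val ff; have eg := congr1 val gg; rewrite /= in ef eg.
  by case/eqP: fg; apply: val_inj => /=; have := ltn_ord f; have := ltn_ord g; lia.
exists f, g; split=> //.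
- by move=> /val_inj e; case/eqP: fg.
- by have := congr1 val sumF => /= <-; have := ltn_ord f; lia.
move=> x; case: (pselect (H x)) => [|Hx]; first by constructor 1.
have xF := gap_le Hx.
case: (pselect (H (F - x)%N)) => [|Hx']; first by constructor 2.
have : (inord x \in gaps :\: duals)%SET.
  by rewrite !inE inordK //; apply/andP; split; apply/asboolP.
rewrite mem => /orP[] /eqP e; have := congr1 val e; rewrite /= inordK // => ->.
  by constructor 3.
by constructor 4.
Qed.

End PseudoFrobenius.

Local Open Scope ring_scope.

(** * Semigroup ideals and RF-relations *)

Section Ideals.
Variables (R : comNzRingType) (S : set R).
Local Notation J := (ideal_generated S).

Lemma ideal_generated0 : J 0.
Proof.
exists 0%N, (fun=> 0), (fun=> 0); split; first by case.
by rewrite big_ord0.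
Qed.

Lemma sub_ideal_generated p : S p -> J p.
Proof.
by move=> Sp; exists 1%N, (fun=> 1), (fun=> p); rewrite big_ord1 mul1r.
Qed.

Lemma ideal_generatedD p q : J p -> J q -> J (p + q).
Proof.
move=> [r [a [g [Sg ->]]]] [s [b [k [Sk ->]]]].
pose c (i : 'I_(r + s)) := match fintype.split i with inl j => a j | inr j => b j end.
pose m (i : 'I_(r + s)) := match fintype.split i with inl j => g j | inr j => k j end.
exists (r + s)%N, c, m; split=> [i|].
  by rewrite /m; case: (fintype.split i).
rewrite big_split_ord /=; congr (_ + _); apply: eq_bigr => i _; rewrite /c /m.
- by case: splitP => j /= e; [congr (a _ * g _); apply: val_inj
    | have := ltn_ord i; rewrite e ltnNge leq_addr].
- by case: splitP => j /= e; [have := ltn_ord j; rewrite -e ltnNge leq_addr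
    | congr (b _ * k _); apply: val_inj; apply: (addnI e)].
Qed.

Lemma ideal_generatedMl p q : J p -> J (q * p).
Proof.
move=> [r [a [g [Sg ->]]]]; exists r, (fun i => q * a i), g; split=> //.
by rewrite mulr_sumr; apply: eq_bigr => i _; rewrite mulrA.
Qed.

Lemma ideal_generatedN p : J p -> J (- p).
Proof. by rewrite -mulN1r; apply: ideal_generatedMl. Qed.

Lemma ideal_generated_sum (I : Type) (r : seq I) (P : pred I) (F : I -> R) :
  (forall i, P i -> J (F i)) -> J (\sum_(i <- r | P i) F i).
Proof.
move=> JF; elim/big_ind: _ => //; [exact: ideal_generated0 | exact: ideal_generatedD].
Qed.

End Ideals.

Section SemigroupIdeal.
Variables (K : fieldType) (k : nat) (n : 'I_k -> nat).

Definition weight (a : 'X_{1..k}) : nat := (\sum_i a i * n i)%N.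

Lemma weightD a b : weight (a + b)%MM = (weight a + weight b)%N.
Proof. by rewrite -big_split; apply: eq_bigr => i _; rewrite mnmDE mulnDl. Qed.

Lemma mmap1_weight a :
  mmap1 (fun i : 'I_k => 'X^(n i)) a = 'X^(weight a) :> {poly K}.
Proof.
by rewrite /mmap1 expr_sum; apply: eq_bigr => i _; rewrite -exprM mulnC.
Qed.

(** [rep m] is the first monomial of the support with the weight of [m]. The correction sum
    vanishes: its part of weight d is a monomial times the coefficient of t^d in the image of
    [p]. *)
Lemma semigroup_ideal_binomials p : semigroup_ideal K n p ->
  exists rep : 'X_{1..k} -> 'X_{1..k},
    {in msupp p, forall m, weight (rep m) = weight m} /\
    p = \sum_(m <- msupp p) p@_m *: ('X_[m] - 'X_[rep m]).
Proof.
move=> p0; pose rep d := nth 0%MM (msupp p) (find (fun m => weight m == d) (msupp p)).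
exists (fun m => rep (weight m)); split=> [m mp|].
  by apply/eqP; apply: (nth_find 0%MM (a := fun m' => weight m' == weight m));
     apply/hasP; exists m.
have -> : \sum_(m <- msupp p) p@_m *: ('X_[m] - 'X_[rep (weight m)]) =
          p - \sum_(m <- msupp p) p@_m *: 'X_[rep (weight m)].
  rewrite [X in _ = X - _]mpolyE -sumrB.
  by apply: eq_bigr => m _; rewrite scalerBr.
suff -> : \sum_(m <- msupp p) p@_m *: 'X_[rep (weight m)] = 0 :> {mpoly K[k]}.
  by rewrite subr0.
pose N := (\max_(m <- msupp p) weight m).+1.
have wN m : m \in msupp p -> (weight m < N)%N.
  by move=> mp; rewrite ltnS (leq_bigmax_seq m).
transitivity (\sum_(d < N) (\sum_(m <- msupp p) p@_m * (weight m == d)%:R) *: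
                'X_[rep d] : {mpoly K[k]}).
  under [RHS]eq_bigr do rewrite scaler_suml.
  rewrite exchange_big /= big_seq [RHS]big_seq; apply: eq_bigr => m mp.
  rewrite (bigD1 (Ordinal (wN m mp))) //= eqxx mulr1 big1 ?addr0 // => d ned.
  have /negbTE -> : weight m != d by apply: contra ned => /eqP e; apply/eqP/val_inj.
  by rewrite mulr0 scale0r.
rewrite big1 // => d _.
have -> : \sum_(m <- msupp p) p@_m * (weight m == d)%:R =
          (mmap (@polyC K) (fun i : 'I_k => 'X^(n i)) p)`_d.
  rewrite /mmap coef_sum; apply: eq_bigr => m _.
  by rewrite mmap1_weight coefCM coefXn eq_sym.
by rewrite p0 coef0 scale0r.
Qed.

Lemma sub_semigroup_ideal (S : set {mpoly K[k]}) :
  (forall a b, weight a = weight b -> ideal_generated S ('X_[a] - 'X_[b])) ->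
  forall p, semigroup_ideal K n p -> ideal_generated S p.
Proof.
move=> Sab p /semigroup_ideal_binomials [rep [wrep ->]].
rewrite big_seq; apply: ideal_generated_sum => m mp.
rewrite -mul_mpolyC; apply: ideal_generatedMl; apply: Sab.
by rewrite wrep.
Qed.

Lemma ideal_generated_sub (S : set {mpoly K[k]}) :
  (forall p, S p -> semigroup_ideal K n p) ->
  forall p, ideal_generated S p -> semigroup_ideal K n p.
Proof.
move=> SI p [r [q [g [Sg ->]]]]; rewrite /semigroup_ideal /= raddf_sum big1 // => i _.
have /= -> := rmorphM (mmap (@polyC K) (fun i : 'I_k => 'X^(n i))) (q i) (g i).
by have /= -> := SI _ (Sg i); rewrite mulr0.
Qed.

End SemigroupIdeal.

(** * Binomials produced by row-factorization matrices *)

Section RFIdeal.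
Variables (K : fieldType) (k : nat) (n : 'I_k -> nat) (H : set nat).
Hypothesis genH : minimally_generated n H.
Local Notation J := (ideal_generated (RF_relation K n H)).

Lemma semigroup_weight m : H m <-> exists a, weight n a = m.
Proof.
split=> [/(semigroupP genH)[c ->]|[a <-]]; last first.
  by apply/(semigroupP genH); exists a.
by exists [multinom c i | i < k]; apply: eq_bigr => i _; rewrite mnmE.
Qed.

Lemma weight1 i : weight n U_(i)%MM = n i.
Proof.
rewrite /weight (bigD1 i) //= mnm1E eqxx mul1n big1 ?addn0 // => j /negbTE ji.
by rewrite mnm1E eq_sym ji mul0n.
Qed.

Lemma mnm_pred (a : 'X_{1..k}) i : (0 < a i)%N -> a = (a - U_(i) + U_(i))%MM.
Proof.
by move=> ai; rewrite submK //; apply/mnm_lepP => j; rewrite mnm1E; case: eqP => [<-|].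
Qed.

Lemma RF_relation_weight p :
  RF_relation K n H p -> exists a b : 'X_{1..k},
    weight n a = weight n b /\ p = 'X_[a] - 'X_[b].
Proof.
move=> [f _ [A [i [j [[_ _ rowA] _ ->]]]]].
set d := row i A - row j A; rewrite /monom.
do 2 eexists; split; last reflexivity.
have wZ (v : 'rV[int]_k) : (forall x, 0 <= v 0 x) ->
    Posz (weight n [multinom `|v 0%R x|%N | x < k]) = \sum_x v 0 x * (n x)%:Z.
  move=> v0; rewrite /weight (big_morph Posz PoszD (erefl _)); apply: eq_bigr => x _.
  by rewrite mnmE PoszM gez0_abs.
apply/eqP; rewrite -eqz_nat; apply/eqP; rewrite !wZ => [|x|x].
- apply/eqP; rewrite -subr_eq0 -sumrB.
  under eq_bigr => x _.
    rewrite -mulrBl (_ : _ - _ = A i x - A j x) ?mulrBl; last by rewrite !mxE; lia.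
    over.
  by rewrite sumrB !rowA subrr.
- by rewrite !mxE; lia.
- by rewrite !mxE; lia.
Qed.

Lemma RF_relation_semigroup_ideal p :
  RF_relation K n H p -> semigroup_ideal K n p.
Proof.
move=> /RF_relation_weight [a [b [ab ->]]].
by rewrite /semigroup_ideal /= mmapB !mmapX !mmap1_weight ab subrr.
Qed.

(* Row [i] of a row-factorization matrix of [p] is [u - e_i], where [u] is a
   factorization of [p + n i]: its diagonal entry is [-1] because [p] is a gap. *)
Lemma PF_row p i (u : 'X_{1..k}) :
  PF' n H (Posz p) -> weight n u = (p + n i)%N -> u i = 0%N.
Proof.
move=> [[Hp _] _] wu; apply/eqP; rewrite -leqn0 leqNgt; apply/negP => ui.
apply: Hp; exists p => //; apply/semigroup_weight; exists (u - U_(i))%MM.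
by move: wu; rewrite {1}(mnm_pred ui) weightD weight1 => /addIn.
Qed.

Lemma PF_row_exists p : PF' n H (Posz p) ->
  exists w : 'I_k -> 'X_{1..k}, forall i, weight n (w i) = (p + n i)%N.
Proof.
move=> [[_ Hp] _].
suff /boolp.choice[w ww] : forall i, exists a, weight n a = (p + n i)%N by exists w.
by move=> i; have [m Hm [<-]] := Hp i; apply/semigroup_weight.
Qed.

Lemma binomial_pos_neg (a b : 'X_{1..k}) (d : 'rV[int]_k) :
  (forall i, d 0 i = (a i)%:Z - (b i)%:Z) ->
  'X_[a] - 'X_[b] = 'X_[[multinom minn (a i) (b i) | i < k]] *
    (monom K (pos_part d) - monom K (neg_part d)).
Proof.
move=> dE; rewrite /monom mulrBr -!mpolyXD.
by congr ('X_[_] - 'X_[_]); apply/mnmP => i;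
   rewrite mnmDE !mnmE !mxE dE; lia.
Qed.

(** Rows can be chosen independently, so [u] and [v] complete to one matrix whose rows i and j
    differ by a - b. The binomial is its RF-relation times the greatest common divisor of the two
    monomials. *)
Lemma RF_binomial_lt p (i j : 'I_k) (u v a b : 'X_{1..k}) :
  PF' n H (Posz p) -> (i < j)%N ->
  weight n u = (p + n i)%N -> weight n v = (p + n j)%N ->
  (a + (v + U_(i)) = b + (u + U_(j)))%MM -> J ('X_[a] - 'X_[b]).
Proof.
move=> Pp ij wu wv ab; have [w ww] := PF_row_exists Pp.
have ji : (j == i) = false by apply/eqP => e; rewrite e ltnn in ij.
pose r x := if x == i then u else if x == j then v else w x.
have wr x : weight n (r x) = (p + n x)%N.
  by rewrite /r; case: eqP => [->|_] //; case: eqP => [->|_].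
pose A : 'M[int]_k := \matrix_(x, y) ((r x y)%:Z - (x == y)%:Z).
have RFA : RF_matrix n (Posz p) A.
  split=> [x|x y xy|x].
  - by rewrite mxE (PF_row Pp (wr x)) eqxx.
  - by rewrite mxE (negbTE xy) subr0.
  under eq_bigr => y _ do rewrite mxE mulrBl.
  rewrite sumrB (bigD1 x (F := fun y => (x == y)%:Z * (n y)%:Z)) //= eqxx mul1r.
  rewrite [X in _ - (_ + X)]big1 => [|y]; last by rewrite eq_sym => /negbTE ->; rewrite mul0r.
  rewrite addr0; under eq_bigr => y _ do rewrite -PoszM.
  by rewrite -(big_morph Posz PoszD (erefl _)) -/(weight n (r x)) wr PoszD addrK.
have dE y : (row i A - row j A) 0 y = (a y)%:Z - (b y)%:Z.
  have /mnmP/(_ y) := ab; rewrite !mnmDE !mnm1E !mxE /r eqxx ji eqxx.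
  by case: (i == y); case: (j == y) => /=; lia.
rewrite (binomial_pos_neg dE); apply: ideal_generatedMl; apply: sub_ideal_generated.
by exists (Posz p) => //; exists A, i, j.
Qed.

Lemma RF_binomial p (i j : 'I_k) (u v a b : 'X_{1..k}) :
  PF' n H (Posz p) -> i != j ->
  weight n u = (p + n i)%N -> weight n v = (p + n j)%N ->
  (a + (v + U_(i)) = b + (u + U_(j)))%MM -> J ('X_[a] - 'X_[b]).
Proof.
move=> Pp ij wu wv ab; case: (ltngtP i j) => [lt|lt|/val_inj e].
- exact: RF_binomial_lt Pp lt wu wv ab.
- rewrite -opprB; apply: ideal_generatedN.
  by apply: RF_binomial_lt Pp lt wv wu _; rewrite ab.
- by rewrite e eqxx in ij.
Qed.

End RFIdeal.

Local Close Scope ring_scope.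

(** * Incongruent monomials of minimal weight *)

Section Indices.

Lemma uniq4_mem (s : seq 'I_4) : uniq s -> size s = 4 -> s =i 'I_4.
Proof.
move=> us ss x; rewrite -[RHS]mem_enum.
have sub : {subset s <= enum 'I_4} by move=> y _; rewrite mem_enum.
have le : (size (enum 'I_4) <= size s)%N by rewrite ss size_enum_ord.
by have [_ ->] := uniq_min_size us sub le.
Qed.

Lemma sum_uniq4 (G : 'I_4 -> nat) i j k l : uniq [:: i; j; k; l] ->
  (\sum_x G x = G i + G j + G k + G l)%N.
Proof.
move=> us; rewrite -[LHS]big_enum.
rewrite (perm_big [:: i; j; k; l]) /=; last first.
  apply: uniq_perm; rewrite ?enum_uniq // => x.
  by rewrite mem_enum (uniq4_mem us).
by rewrite !big_cons big_nil addn0 !addnA.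
Qed.

Lemma uniq4_complete (i j : 'I_4) : i != j -> exists k l, uniq [:: i; j; k; l].
Proof.
have : [forall i : 'I_4, forall j : 'I_4, (i != j) ==>
  [exists k : 'I_4, exists l : 'I_4, uniq [:: i; j; k; l]]].
  apply/forallP => a; apply/forallP => b; apply/implyP => ab.
  have /card_gt0P[k] : (0 < #|~: [set a; b]|)%N by rewrite cardsCs finset.setCK card_ord cards2 ab.
  rewrite !inE negb_or => /andP[ka kb].
  have /card_gt0P[l] : (0 < #|~: [set a; b; k]|)%N.
    rewrite cardsCs finset.setCK card_ord subn_gt0.
    by rewrite (leq_ltn_trans (leq_card_setU _ _)) // cards1 cards2; case: (_ != _).
  rewrite !inE !negb_or => /andP[/andP[la lb] lk].
  apply/existsP; exists k; apply/existsP; exists l.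
  by rewrite /= !inE !negb_or ab !(eq_sym a) !(eq_sym b) ka la kb lb eq_sym lk.
move=> /forallP/(_ i)/forallP/(_ j)/implyP all4 /all4 /existsP[k /existsP[l u]].
by exists k, l.
Qed.

End Indices.

Section Step.
Local Open Scope Z_scope.
Variables (K : fieldType) (n : 'I_4 -> nat) (H : set nat) (f g : nat).
Hypotheses (semiH : numerical_semigroup H) (genH : minimally_generated n H).
Hypotheses (PFf : PF' n H (Posz f)) (PFg : PF' n H (Posz g)) (fg : f <> g).
Hypotheses (gap_f : ~ H f) (gap_g : ~ H g) (gap_F : ~ H (f + g)%N).
Hypothesis gaps_bounded : forall m, (f + g < m)%N -> H m.
Hypothesis gaps_dual : forall m,
  [\/ H m, (m <= f + g)%N /\ H (f + g - m)%N, m = f | m = g].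

Local Notation N i := (Z.of_nat (n i)).
Local Notation fZ := (Z.of_nat f).
Local Notation gZ := (Z.of_nat g).
Local Notation w := (weight n).

Definition in_Z x := exists2 m, H m & x = Z.of_nat m.

Lemma in_ZP x m : x = Z.of_nat m -> in_Z x <-> H m.
Proof. by move=> ->; split=> [[m' Hm /Nat2Z.inj ->]|Hm] //; exists m. Qed.

Lemma weight4 a i j k l : uniq [:: i; j; k; l] ->
  w a = (a i * n i + a j * n j + a k * n k + a l * n l)%N.
Proof. exact: (sum_uniq4 (fun x => a x * n x)%N). Qed.

Lemma fact4 i j k l a b c d : uniq [:: i; j; k; l] -> exists m : 'X_{1..4},
  [/\ m i = a, m j = b, m k = c & m l = d].
Proof.
rewrite /= !inE !negb_or => /andP[/and3P[ij ik il]] /andP[/andP[jk jl]] /andP[kl _].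
exists [multinom if x == i then a else if x == j then b else if x == k then c else d | x < 4].
rewrite !mnmE !eqxx (eq_sym j i) (negbTE ij) (eq_sym k i) (negbTE ik).
rewrite (eq_sym l i) (negbTE il) (eq_sym k j) (negbTE jk).
by rewrite (eq_sym l j) (negbTE jl) (eq_sym l k) (negbTE kl).
Qed.

Lemma gensP i j k l x : uniq [:: i; j; k; l] ->
  gens (N i) (N j) (N k) (N l) x <-> in_Z x.
Proof.
move=> u; split=> [[a [b [c [d [[? [? [? ?]]] ->]]]]]|[m /(semigroup_weight genH)[a <-] ->]].
  have [m [mi mj mk ml]] := fact4 (Z.to_nat a) (Z.to_nat b) (Z.to_nat c) (Z.to_nat d) u.
  exists (w m); first by apply/(semigroup_weight genH); exists m.
  by rewrite (weight4 m u) mi mj mk ml; lia.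
exists (Z.of_nat (a i)), (Z.of_nat (a j)), (Z.of_nat (a k)), (Z.of_nat (a l)).
by split; [lia|rewrite (weight4 a u); lia].
Qed.

Lemma in_Z_dual x : in_Z x \/ in_Z (fZ + gZ - x) \/ x = fZ \/ x = gZ.
Proof.
(* For negative x the reflected number exceeds F. *)
case: (Z.lt_ge_cases x 0) => x0.
  right; left; exists (Z.to_nat (fZ + gZ - x)); last by lia.
  by apply: gaps_bounded; lia.
have ex : x = Z.of_nat (Z.to_nat x) by lia.
case: (gaps_dual (Z.to_nat x)) => [Hx|[xF Hx]|e|e].
- by left; exists (Z.to_nat x).
- by right; left; exists (f + g - Z.to_nat x)%N => //; lia.
- by right; right; left; lia.
- by right; right; right; lia.
Qed.

Lemma PF_in_Z p i : PF' n H (Posz p) -> in_Z (Z.of_nat p + N i).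
Proof.
by move=> [[_ Hp] _]; have [m Hm [e]] := Hp i; exists m => //; lia.
Qed.

Lemma notin3_gen i j k l : uniq [:: i; j; k; l] ->
  notin3 (N j) (N k) (N l) (N i).
Proof.
move=> u b c d b0 c0 d0 e.
have [m [mi mj mk ml]] := fact4 0%N (Z.to_nat b) (Z.to_nat c) (Z.to_nat d) u.
apply: (gen_notin_span genH (j := i) (c := m)).
have := weight4 m u; rewrite /weight (bigD1 i) //= mi mul0n add0n => ->.
by rewrite mj mk ml; lia.
Qed.

Lemma uniq4_12 (i j k l : 'I_4) : uniq [:: i; j; k; l] -> uniq [:: j; i; k; l].
Proof. by rewrite -(perm_uniq (s1 := [:: i; j; k; l])) // (perm_catCA [:: i] [:: j]). Qed.

Lemma uniq4_23 (i j k l : 'I_4) : uniq [:: i; j; k; l] -> uniq [:: i; k; j; l].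
Proof. by rewrite -(perm_uniq (s1 := [:: i; j; k; l])) // perm_cons (perm_catCA [:: j] [:: k]). Qed.

Lemma uniq4_34 (i j k l : 'I_4) : uniq [:: i; j; k; l] -> uniq [:: i; j; l; k].
Proof.
by rewrite -(perm_uniq (s1 := [:: i; j; k; l])) // !perm_cons (perm_catCA [:: k] [:: l]).
Qed.

Lemma almost_sym_semigroup i j k l : uniq [:: i; j; k; l] ->
  almost_sym (N i) (N j) (N k) (N l) fZ gZ.
Proof.
move=> u; have G x := gensP x u; have npos := gen_gt0 genH.
have H0 := semigroup0 semiH.
have f0 : (0 < f)%N by rewrite lt0n; apply/eqP => e; case: gap_f; rewrite e.
have g0 : (0 < g)%N by rewrite lt0n; apply/eqP => e; case: gap_g; rewrite e.
split; rewrite ?G.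
- by rewrite (in_ZP (m := (f + g)%N)) //; lia.
- by rewrite (in_ZP (m := f)).
- by rewrite (in_ZP (m := g)).
- by lia.
- by have := (npos i, npos j, npos k, npos l) => -[[[]]]; lia.
all: try exact: PF_in_Z.
- exact: notin3_gen.
- exact/notin3_gen/uniq4_12.
- exact/notin3_gen/uniq4_12/uniq4_23.
- exact/notin3_gen/uniq4_12/uniq4_23/uniq4_34.
by move=> x; rewrite !G; exact: in_Z_dual.
Qed.

(** * Congruence of monomials of weight h *)

Variable h : nat.
Local Notation hZ := (Z.of_nat h).
Local Notation link a b :=
  (ideal_generated (RF_relation K n H) ('X_[a] - 'X_[b])%R).
Hypothesis IH : forall a b, w a = w b -> (w a < h)%N -> link a b.

Lemma link_sym a b : link a b -> link b a.
Proof. by move=> /ideal_generatedN; rewrite opprB. Qed.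

Lemma link_trans a b c : link a b -> link b c -> link a c.
Proof.
move=> ab bc; have := ideal_generatedD ab bc.
by rewrite addrA subrK.
Qed.

(** Dividing out the common variable lowers the weight, so the induction hypothesis applies. *)
Lemma link_shared a b i : w a = h -> w b = h -> (0 < a i)%N -> (0 < b i)%N ->
  link a b.
Proof.
move=> wa wb ai bi; have npos := gen_gt0 genH i.
rewrite (mnm_pred ai) (mnm_pred bi) !mpolyXD -mulrBl mulrC.
have ea := congr1 w (mnm_pred ai); have eb := congr1 w (mnm_pred bi).
rewrite !weightD !weight1 wa wb in ea eb.
by apply: ideal_generatedMl; apply: IH; lia.
Qed.

Definition supp i := exists2 a, w a = h & (0 < a i)%N.
(** By [link_shared] the choice of the two monomials is immaterial: on the support this is the
    complement of an equivalence relation on indices. *)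
Definition apart i j := exists a b,
  [/\ w a = h, w b = h, (0 < a i)%N, (0 < b j)%N & ~ link a b].

Lemma suppP i : supp i <-> in_Z (hZ - N i).
Proof.
split=> [[a wa ai]|[m /(semigroup_weight genH)[a <-] e]].
  have ea := congr1 w (mnm_pred ai); rewrite weightD weight1 wa in ea.
  exists (w (a - U_(i))%MM); last by lia.
  by apply/(semigroup_weight genH); exists (a - U_(i))%MM.
exists (a + U_(i))%MM; first by rewrite weightD weight1; lia.
by rewrite mnmDE mnm1E eqxx addn1.
Qed.

Lemma apart_supp i j : apart i j -> supp i /\ supp j.
Proof. by move=> [a [b [wa wb ai bj _]]]; split; [exists a|exists b]. Qed.

Lemma apart_sym i j : apart i j -> apart j i.
Proof.
by move=> [a [b [wa wb ai bj ab]]]; exists b, a; split=> // /link_sym.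
Qed.

Lemma apart_or i j k : apart i j -> supp k -> apart i k \/ apart k j.
Proof.
move=> [a [b [wa wb ai bj ab]]] [c wc ck].
case: (pselect (link a c)) => [ac|ac]; last by left; exists a, c.
right; exists c, b; split=> // cb; apply: ab; exact: link_trans ac cb.
Qed.

Lemma apart_notin i j a : apart i j -> w a = h -> (0 < a i)%N -> a j = 0%N.
Proof.
move=> [c [d [wc wd ci dj cd]]] wa ai; apply/eqP; rewrite -leqn0 leqNgt.
apply/negP => aj; apply: cd.
exact: link_trans (link_shared wc wa ci ai) (link_shared wa wd aj dj).
Qed.

Lemma apart_neq i j : apart i j -> i != j.
Proof.
move=> ij; apply/eqP => e; have [[a wa ai] _] := apart_supp ij.
by have := apart_notin ij wa ai; rewrite -e => e0; rewrite e0 in ai.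
Qed.

Lemma apart_PF_row p i j u v a b : PF' n H (Posz p) -> i != j ->
  w u = (p + n i)%N -> w v = (p + n j)%N ->
  (b + (v + U_(i)) = a + (u + U_(j)))%MM -> link a b.
Proof.
move=> Pp ij wu wv e; apply: link_sym; exact: (RF_binomial K genH Pp ij wu wv e).
Qed.

Lemma apart_cross i j k l i' j' : uniq [:: i; j; k; l] -> apart i' j' ->
  cross (N i) (N j) (N k) (N l) fZ gZ hZ (N i') (N j').
Proof.
move=> u ij; have G x := gensP x u.
have [si sj] := apart_supp ij; have ij' := apart_neq ij.
have [a [b [wa wb ai bj ab]]] := ij.
have ea := mnm_pred ai; have eb := mnm_pred bj.
have wa1 := congr1 w ea; have wb1 := congr1 w eb.
rewrite !weightD !weight1 wa wb in wa1 wb1.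
set a1 := (a - U_(i'))%MM in ea wa1; set b1 := (b - U_(j'))%MM in eb wb1.
have Npq : ~ in_Z (hZ - N i' - N j').
  move=> [m /(semigroup_weight genH)[r <-] e]; apply: ab.
  pose c := (r + U_(i') + U_(j'))%MM.
  have wc : w c = h by rewrite !weightD !weight1; lia.
  have ci : (0 < c i')%N by rewrite !mnmDE !mnm1E eqxx; lia.
  have cj : (0 < c j')%N by rewrite !mnmDE !mnm1E eqxx; lia.
  exact: link_trans (link_shared wa wc ai ci) (link_shared wc wb cj bj).
have PFn p : PF' n H (Posz p) -> ~ in_Z (Z.of_nat p + N i' + N j' - hZ).
  move=> Pp [m /(semigroup_weight genH)[r <-] e]; apply: ab.
  (* These factor p + n_i' and p + n_j', so the corresponding rows differ by b - a, the summand r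
     cancelling. *)
  apply: (apart_PF_row Pp ij' (u := (b1 + r)%MM) (v := (a1 + r)%MM)).
  - by rewrite weightD; lia.
  - by rewrite weightD; lia.
  by rewrite eb ea; apply/mnmP => x; rewrite !mnmDE; lia.
have PFp p : PF' n H (Posz p) -> hZ - N i' - N j' <> Z.of_nat p.
  move=> Pp e; apply: ab; apply: (apart_PF_row Pp ij' (u := b1) (v := a1)).
  - by lia.
  - by lia.
  by rewrite eb ea; apply/mnmP => x; rewrite !mnmDE; lia.
split; rewrite G //.
- exact/suppP.
- exact/suppP.
- have -> : fZ + gZ + N i' + N j' - hZ = fZ + gZ - (hZ - N i' - N j') by lia.
  by have [//|[//|[/(PFp _ PFf)|/(PFp _ PFg)]]] := in_Z_dual (hZ - N i' - N j').
- exact: PFn.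
- exact: PFn.
Qed.

Definition pure i := forall a, w a = h -> (0 < a i)%N ->
  forall j, j != i -> a j = 0%N.

(** A relation for a smaller positive multiple of n_i could replace that many copies of n_i in h,
    leaving a factorization that uses i and another index. *)
Lemma pure_lowest i j k l : uniq [:: i; j; k; l] -> supp i -> pure i ->
  exists al, hZ = al * N i /\ lowest (N i) (N j) (N k) (N l) al.
Proof.
move=> u [a wa ai] pi; have npos := gen_gt0 genH.
have : uniq [:: i; j; k; l] by [].
rewrite /= !inE !negb_or => /andP[/and3P[ij ik il] _].
have ea : h = (a i * n i)%N.
  have z := pi _ wa ai.
  by rewrite -wa (weight4 a u) (z j) ?(z k) ?(z l) 1?eq_sym //; lia.
have nat_Z x : 0 <= x -> exists y, x = Z.of_nat y by exists (Z.to_nat x); lia.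
exists (Z.of_nat (a i)); split; first by lia.
move=> m b c d m0 /nat_Z[b' ->] /nat_Z[c' ->] /nat_Z[d' ->].
have [m' em] := nat_Z m (Z.lt_le_incl _ _ m0); rewrite em in m0 * => e.
case: (leqP (a i) m') => [|lt]; first by lia.
have [q eq] : exists q, (a i = q + m')%N by exists (a i - m')%N; lia.
have q0 : (0 < q)%N by lia.
have [r [ri rj rk rl]] := fact4 q b' c' d' u.
have wr : w r = h by rewrite ea eq (weight4 r u) ri rj rk rl; lia.
have zr x : x != i -> r x = 0%N by apply: (pi r wr); rewrite ri.
have := zr j; have := zr k; have := zr l; rewrite !(eq_sym _ i) ij ik il rj rk rl.
move=> /(_ isT) ed /(_ isT) ec /(_ isT) eb; rewrite ed ec eb in e.
by have := npos i; nia.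
Qed.

Lemma apart_pure i : (forall j, j != i -> supp j -> apart i j) -> pure i.
Proof.
move=> ap a wa ai j ji; apply/eqP; rewrite -leqn0 leqNgt; apply/negP => aj.
have ij : apart i j by apply: ap => //; exists a.
by rewrite (apart_notin ij wa ai) in aj.
Qed.

Lemma unmixed_class i k : ~ (exists2 a, w a = h & (0 < a i)%N && (0 < a k)%N) ->
  (forall j, j != i -> j != k -> apart i j) -> pure i.
Proof.
move=> nomix ap a wa ai j ji.
case: (eqVneq j k) => [->|jk]; last exact: apart_notin (ap j ji jk) wa ai.
apply/eqP; rewrite -leqn0 leqNgt; apply/negP => ak.
by apply: nomix; exists a; rewrite ?ai.
Qed.

Lemma uniq4_ind (P : 'I_4 -> Prop) i j k l : uniq [:: i; j; k; l] ->
  P i -> P j -> P k -> P l -> forall x, P x.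
Proof.
move=> u Pi Pj Pk Pl x; have : x \in [:: i; j; k; l] by rewrite (uniq4_mem u).
by rewrite !inE => /or4P[] /eqP ->.
Qed.

(** * Exclusion of each shape of the partition *)

Lemma no_full_classes i j k l : uniq [:: i; j; k; l] ->
  apart i j -> apart i k -> apart i l -> False.
Proof.
move=> u ij ik il; have [si _] := apart_supp ij.
have pi : pure i.
  by apply: apart_pure; apply: (uniq4_ind u) => //; rewrite eqxx.
have [al [e low]] := pure_lowest u si pi.
exact: (no_full (almost_sym_semigroup u) (apart_cross u ij) (apart_cross u ik)
  (apart_cross u il) e low).
Qed.

Lemma no_two_classes i j k l : uniq [:: i; j; k; l] -> ~ supp l ->
  apart i j -> apart i k -> False.
Proof.
move=> u nl ij ik; have [si _] := apart_supp ij.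
have pi : pure i.
  by apply: apart_pure; apply: (uniq4_ind u) => //; rewrite eqxx.
have [al [e low]] := pure_lowest u si pi.
apply: (no_two (almost_sym_semigroup u) (apart_cross u ij) (apart_cross u ik) e low).
by rewrite (gensP _ u) => /suppP.
Qed.

Lemma no_one_classes i j k l : uniq [:: i; j; k; l] -> ~ supp k -> ~ supp l ->
  apart i j -> False.
Proof.
move=> u nk nl ij; have [si sj] := apart_supp ij; have ji := apart_sym ij.
have pi : pure i by apply: apart_pure; apply: (uniq4_ind u) => //; rewrite eqxx.
have pj : pure j by apply: apart_pure; apply: (uniq4_ind u) => //; rewrite eqxx.
have [al [e low]] := pure_lowest u si pi.
have [be [e' _]] := pure_lowest (uniq4_12 u) sj pj.
apply: (no_one (almost_sym_semigroup u) (apart_cross u ij) e e' low).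
  by rewrite (gensP _ u) => /suppP.
by rewrite (gensP _ u) => /suppP.
Qed.

(* The classes are [{i, j}] and [{k, l}]. *)
Lemma no_unmixed_classes i j k l : uniq [:: i; j; k; l] ->
  apart i k -> apart i l -> apart j k -> apart j l ->
  ~ (exists2 a, w a = h & (0 < a i)%N && (0 < a j)%N) -> False.
Proof.
move=> u ik il jk jl nomix; have [si sk] := apart_supp ik; have [sj sl] := apart_supp jl.
have pi : pure i.
  by apply: (unmixed_class nomix); apply: (uniq4_ind u) => //; rewrite eqxx.
have pj : pure j.
  apply: (unmixed_class (k := i)); last by apply: (uniq4_ind u) => //; rewrite eqxx.
  by move=> [a wa /andP[aj ai]]; apply: nomix; exists a; rewrite ?ai.
have u' : uniq [:: i; k; l; j] := uniq4_34 (uniq4_23 u).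
have [al [e low]] := pure_lowest u' si pi.
have [be [e' low']] := pure_lowest (uniq4_12 u) sj pj.
exact: (no_pure (almost_sym_semigroup u') (apart_cross u' ik) (apart_cross u' il)
  (apart_cross u' jk) (apart_cross u' jl) e e' low low').
Qed.

Lemma no_twotwo_classes i j k l : uniq [:: i; j; k; l] ->
  apart i k -> apart i l -> apart j k -> apart j l -> False.
Proof.
move=> u ik il jk jl.
case: (pselect (exists2 a, w a = h & (0 < a i)%N && (0 < a j)%N)); last first.
  exact: no_unmixed_classes u ik il jk jl.
move=> [a wa /andP[ai aj]].
case: (pselect (exists2 a, w a = h & (0 < a k)%N && (0 < a l)%N)); last first.
  have u' : uniq [:: k; l; i; j].
    exact: uniq4_23 (uniq4_12 (uniq4_34 (uniq4_23 u))).
  apply: (no_unmixed_classes u'); exact: apart_sym.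
move=> [b wb /andP[bk bl]].
apply: (no_twotwo (v1 := Z.of_nat (a i)) (v2 := Z.of_nat (a j))
  (w3 := Z.of_nat (b k)) (w4 := Z.of_nat (b l))
  (almost_sym_semigroup u) (apart_cross u ik) (apart_cross u il)
  (apart_cross u jk) (apart_cross u jl)); try lia.
- by rewrite -wa (weight4 a u) (apart_notin ik wa ai) (apart_notin il wa ai); lia.
rewrite -wb (weight4 b u) (apart_notin (apart_sym ik) wb bk).
by rewrite (apart_notin (apart_sym jk) wb bk); lia.
Qed.

(** With full support, either i or j is apart from all other indices, or [apart_or] yields two pairs
    all of whose cross pairs are apart; the indices within a pair need not be congruent. *)
Lemma not_apart i j : ~ apart i j.
Proof.
move=> ij; have ji := apart_sym ij.
have [k [l u]] := uniq4_complete (apart_neq ij).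
have uj := uniq4_12 u; have ul := uniq4_34 u; have ujl := uniq4_34 uj.
case: (pselect (supp k)) => sk; case: (pselect (supp l)) => sl.
- case: (pselect (apart i k)) => ik; case: (pselect (apart i l)) => il.
  + exact: no_full_classes u ij ik il.
  + case: (apart_or ij sl) => // lj; case: (apart_or ik sl) => // lk.
    exact: (no_twotwo_classes (uniq4_23 (uniq4_34 u)) ij ik lj lk).
  + case: (apart_or ij sk) => // kj; case: (apart_or il sk) => // kl.
    exact: (no_twotwo_classes (uniq4_23 u) ij il kj kl).
  + case: (apart_or ij sk) => // /apart_sym jk; case: (apart_or ij sl) => // /apart_sym jl.
    exact: (no_full_classes uj ji jk jl).
- case: (apart_or ij sk) => [ik|/apart_sym jk].
    exact: (no_two_classes u sl ij ik).
  exact: (no_two_classes uj sl ji jk).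
- case: (apart_or ij sl) => [il|/apart_sym jl].
    exact: (no_two_classes ul sk ij il).
  exact: (no_two_classes ujl sk ji jl).
- exact: (no_one_classes u sk sl ij).
Qed.

Lemma link_weight a b : w a = h -> w b = h -> link a b.
Proof.
move=> wa wb; case: (pselect (link a b)) => // ab.
have npos := gen_gt0 genH.
have nz c : w c = h -> (exists i, (0 < c i)%N) \/ h = 0%N.
  move=> wc; case: (pselect (exists i, (0 < c i)%N)) => [|no]; [by left|right].
  rewrite -wc /weight big1 // => i _; case: (posnP (c i)) => [->|ci] //.
  by case: no; exists i.
have h0 c : w c = h -> h = 0%N -> c = 0%MM.
  move=> wc eh; apply/mnmP => i; rewrite mnm0E; apply/eqP; rewrite -leqn0 leqNgt.
  apply/negP => ci; have := congr1 w (mnm_pred ci).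
  by rewrite weightD weight1 wc; have := npos i; lia.
have l00 : link 0%MM 0%MM by rewrite subrr; exact: ideal_generated0.
case: (nz _ wa) => [[i ai]|e]; last by rewrite (h0 _ wa e) (h0 _ wb e).
case: (nz _ wb) => [[j bj]|e]; last by rewrite (h0 _ wa e) (h0 _ wb e).
by case: (@not_apart i j); exists a, b.
Qed.

End Step.

Theorem mainTheorem7 (K : fieldType) (n : 'I_4 -> nat) (H : set nat)
    (H_semigroup : numerical_semigroup H)
    (H_proper : H <> [set: nat]%classic)
    (n_gen : minimally_generated n H)
    (H_almost_symmetric : almost_symmetric n H)
    (H_type3 : semigroup_type n H = 3) :
  semigroup_ideal K n = ideal_generated (RF_relation K n H).
Proof.
have [f [g [fg fgF [PFf PFg] [gap_f gap_g] dual]]] :=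
  PF_type3 (isT : 1 < 4) H_semigroup H_proper n_gen H_almost_symmetric H_type3.
have gap_F := Frobenius_gap H_semigroup H_proper.
have bounded := gt_Frobenius H_semigroup.
apply/seteqP; split=> p; last first.
  by apply: ideal_generated_sub; exact: RF_relation_semigroup_ideal.
apply: sub_semigroup_ideal => a b; move: {-1}(weight n b) (erefl (weight n b)).
move=> h; elim/ltn_ind: h a b => h IH a b wb wa.
apply: (link_weight H_semigroup n_gen PFf PFg fg gap_f gap_g _ _ _ _ wa wb).
- by rewrite fgF.
- by rewrite fgF.
- by rewrite fgF.
- by move=> c d cd ch; apply: (IH _ ch c d); rewrite ?cd.
Qed.
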